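(* Let $X$ be a smooth complex cubic surface with a faithful action of a finite group $G$. Suppose $H$ is a subgroup of $G$ of index $2$. If $X$ is $H$-unirational, then $X$ is $G$-unirational.
   Context: The base field is $\mathbb{C}$. For a finite group $G$, a variety $X$ with a $G$-action is called $G$-unirational if there exists a dominant $G$-equivariant rational map $V \dashrightarrow X$, where $V$ is a faithful linear representation of $G$. For a subgroup $H\subset G$, ''$H$-unirational'' refers to the restricted action. *)

(* Defs.v *)
From HB Require Import structures.
From mathcomp Require Export all_boot all_order all_algebra all_fingroup.
From mathcomp Require Export mxrepresentation.
From mathcomp Require Export mpoly.
From mathcomp Require Export reals complex.

Set Implicit Arguments.
Unset Strict Implicit.
Unset Printing Implicit Defensive.

Import GRing.Theory.
Local Open Scope ring_scope.

(* Value at the vector v of the polynomial map K^n -> K^m with components f. *)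
Definition peval (K : fieldType) (n m : nat) (f : 'I_m -> {mpoly K[n]})
    (v : 'rV[K]_n) : 'rV[K]_m :=
  \row_i (f i).@[v 0].

(* The last clause is the Jacobian criterion; it also forces F != 0, and the  *)
(* surface F = 0 to be reduced and irreducible.                               *)
Definition smooth_cubic (K : closedFieldType) (F : {mpoly K[4]}) : Prop :=
  F \is 3.-homog /\
  forall v : 'rV[K]_4, v != 0 -> F.@[v 0] = 0 ->
    exists i : 'I_4, (F^`M(i)).@[v 0] != 0.

(* The closed points of the surface F = 0 in P^3, a point of P^3 being a line *)
(* through the origin of K^4. For homogeneous F the condition does not depend *)
(* on the nonzero vector vpick L chosen on the line L.                        *)
Definition surface (K : closedFieldType) (F : {mpoly K[4]}) : Type :=
  {L : {vspace 'rV[K]_4} | (\dim L == 1%N) && (F.@[vpick L 0] == 0)}.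

Section Surface.
Variables (K : closedFieldType) (F : {mpoly K[4]}).

Definition line (x : surface F) : {vspace 'rV[K]_4} := val x.

Definition coords (x : surface F) : 'rV[K]_4 := vpick (line x).

(* Morphism of projective varieties: around each point it is given by forms   *)
(* of the same degree without common zero there.                              *)
Definition regular_map (phi : surface F -> surface F) : Prop :=
  forall x : surface F, exists (d : nat) (f : 'I_4 -> {mpoly K[4]}),
    [/\ forall i, f i \is d.-homog,
        peval f (coords x) != 0
      & forall y : surface F, peval f (coords y) != 0 ->
          line (phi y) = <[peval f (coords y)]>%VS].

(* Rational map K^n --> X, v |-> [f_0(v) : ... : f_3(v)]; every rational map  *)
(* to X is of this form, after clearing denominators.                         *)
Definition rational_map_to (n : nat) (f : 'I_4 -> {mpoly K[n]}) : Prop :=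
  (exists i, f i != 0) /\ forall v : 'rV[K]_n, F.@[peval f v 0] = 0.

(* The image is Zariski dense in X. *)
Definition dominant (n : nat) (f : 'I_4 -> {mpoly K[n]}) : Prop :=
  forall (d : nat) (P : {mpoly K[4]}), P \is d.-homog ->
    (forall v : 'rV[K]_n, peval f v != 0 -> P.@[peval f v 0] = 0) ->
    forall x : surface F, P.@[coords x 0] = 0.

Section Action.
Variable gT : finGroupType.

(* As everywhere in MathComp, groups act on the right, both on X and on row   *)
(* vectors; inverting group elements gives the left actions.                  *)

Definition regular_action (G : {group gT}) (to : action G (surface F)) : Prop :=
  forall g, g \in G -> regular_map (to^~ g).

Definition faithful_action (G : {group gT}) (to : action G (surface F)) : Prop :=
  forall g, g \in G -> (forall x, to x g = x) -> g = 1%g.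

(* Equality of the rational maps v |-> f(v).g and v |-> f(v.g) on the dense   *)
(* open set where both f(v) and f(v.g) are nonzero.                           *)
Definition equivariant (H : {group gT}) (to : surface F -> gT -> surface F)
    (n : nat) (rH : mx_representation K H n) (f : 'I_4 -> {mpoly K[n]}) : Prop :=
  forall g, g \in H -> forall (v : 'rV[K]_n) (x : surface F),
    peval f v != 0 -> peval f (v *m rH g) != 0 ->
    line x = <[peval f v]>%VS ->
    line (to x g) = <[peval f (v *m rH g)]>%VS.

Definition unirational (H : {group gT}) (to : surface F -> gT -> surface F)
    : Prop :=
  exists (n : nat) (rH : mx_representation K H n) (f : 'I_4 -> {mpoly K[n]}),
    [/\ mx_faithful rH, rational_map_to f, dominant f & equivariant to rH f].

End Action.
End Surface.

(* Main.v *)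
From mathcomp Require Import ring separable boolp.
Require Import Defs.
Set Implicit Arguments.
Unset Strict Implicit.
Unset Printing Implicit Defensive.
Import GRing.Theory.

(** Let [f : V --> X] be dominant and [H]-equivariant, and let [s] be in [G] but
not in [H]. A vector [w = (v1, v2)] of the representation [W] of [G] induced by
[V] gives two points of [X], namely [f v1] and the image of [f v2] under [s]
([leg1] and [leg2]), which [G] permutes up to its action on [X]
([legs_permuted]). The line through them meets the cubic [X] in a third point
([residual], [third]), so that [w |-> third w] is a [G]-equivariant rational map
from [W] to [X]. It is dominant because the two points are independent and every
point of [X] is the third point of some chord ([residual_surj],
[dominant_pair]). An element of [G] acting trivially on [W] would fix a dense set
of points of [X]; so [W] is faithful.

Equivariance requires that automorphisms of [X] preserve collinear triples. This
holds because they are induced by linear maps: the anticanonical sheaf is O(1).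
The proof below makes this explicit. On the affine cone over [X] there is a
two-form [eta], with [det4 x u v w = eta x u v * dird F x w] for tangent vectors
[u] and [v], which is killed by the Euler field and has weight one. If forms [f]
represent an automorphism near a point, the pull-back of [eta] by [f] is a
multiple [h] of [eta]; dividing [f] by [h] gives a lift of the automorphism to the
cone that does not depend on [f], has weight one and is regular everywhere
([weight1_lift]). The function [h] has no zeros because automorphisms are
immersions ([represents_immersion]), and the quotient is independent of [f]
because functions that vanish on the cone have vanishing tangential derivatives
([tangential_derivative]).

A map of weight one is linear on the three points of a chord ([weight1_chord]).
The plane section of [X] by a plane containing the chord is a plane cubic, finite
of degree three over the lines of a pencil in the plane, one of which is the
chord. A regular function on it is a polynomial of degree at most two in the
coordinate [t] along these lines ([regular_on_curve]). The coefficient of [t ^+ 2]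
is a regular function on the projective line parametrizing the pencil, with
values in O(-1), hence zero ([no_weight_minus1]). This is Abel's
theorem for the plane cubic. *)

Local Open Scope ring_scope.

(** * Polynomial functions over an algebraically closed field *)

Lemma row_nz (K : fieldType) n (v : 'rV[K]_n) : v != 0 -> exists i, v 0 i != 0.
Proof.
move=> v0; apply/existsP; apply: contraNT v0 => /existsPn v0.
by apply/eqP/rowP => i; rewrite mxE; apply/eqP/negPn.
Qed.

Section Univariate.
Variable K : closedFieldType.

Lemma poly_nonroot (p : {poly K}) : p != 0 -> exists x, p.[x] != 0.
Proof.
move=> p0; have: size (p * 'X + 1) != 1%N.
  by rewrite size_MXaddC (negbTE p0) /= eqSS size_poly_eq0.
case/closed_rootP => x; rewrite rootE !hornerE => /eqP px.
exists x; apply/eqP => px0; move: px; rewrite px0 mul0r add0r => /eqP.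
by rewrite oner_eq0.
Qed.

Lemma poly_fun0 (p : {poly K}) : (forall x, p.[x] = 0) -> p = 0.
Proof.
move=> p0; apply/eqP/negPn/negP => /poly_nonroot[x].
by rewrite p0 eqxx.
Qed.

Lemma poly_fun_inj (p q : {poly K}) : (forall x, p.[x] = q.[x]) -> p = q.
Proof.
move=> pq; apply/eqP; rewrite -subr_eq0; apply/eqP/poly_fun0 => x.
by rewrite !hornerE pq subrr.
Qed.

End Univariate.

Section PolynomialFunctions.
Variable K : closedFieldType.

Lemma mpoly_ring_ind (R : comNzRingType) n (P : {mpoly R[n]} -> Prop) :
  (forall c, P c%:MP) -> (forall i, P 'X_i) ->
  (forall p q, P p -> P q -> P (p + q)) ->
  (forall p q, P p -> P q -> P (p * q)) -> forall p, P p.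
Proof.
move=> PC PX PD PM; elim/mpolyind => [|c m p _ _ Pp]; first by rewrite -mpolyC0.
apply: (PD) => //; rewrite -mul_mpolyC; apply: (PM) => //.
rewrite mpolyXE_id; apply: (big_ind P) => [|p1 p2|i _]; [by rewrite -mpolyC1|exact: PM|].
elim: (m i) => [|k IHk]; first by rewrite expr0 -mpolyC1.
by rewrite exprS; apply: (PM).
Qed.

(** Composing the substitution of ring elements for the variables with a
retraction onto the base field recovers evaluation; this is how a polynomial
is restricted to a parametrized line or plane. *)
Lemma mmap_retract (S : comNzRingType) (h : {rmorphism K -> S})
    (e : {rmorphism S -> K}) n (V : 'I_n -> S) (p : {mpoly K[n]}) :
  cancel h e -> e (mmap h V p) = p.@[e \o V].
Proof.
move=> he; rewrite mevalE /mmap rmorph_sum; apply: eq_bigr => m _.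
rewrite rmorphM he /mmap1 rmorph_prod; congr (_ * _).
by apply: eq_bigr => i _; rewrite rmorphXn.
Qed.

Definition polyfun n (h : 'rV[K]_n -> K) : Prop :=
  exists p : {mpoly K[n]}, forall v, h v = p.@[v 0].

Definition polymap n m (h : 'rV[K]_n -> 'rV[K]_m) : Prop :=
  forall i, polyfun (fun v => h v 0 i).

Lemma polyfun_ext n (h1 h2 : 'rV[K]_n -> K) :
  h1 =1 h2 -> polyfun h1 -> polyfun h2.
Proof. by move=> h12 [p hp]; exists p => v; rewrite -h12 hp. Qed.

Lemma polyfun_mpoly n (p : {mpoly K[n]}) : polyfun (fun v => p.@[v 0]).
Proof. by exists p. Qed.

Lemma polyfun_cst n c : polyfun (fun _ : 'rV[K]_n => c).
Proof. by exists c%:MP => v; rewrite mevalC. Qed.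

Lemma polyfun_coord n i : polyfun (fun v : 'rV[K]_n => v 0 i).
Proof. by exists 'X_i => v; rewrite mevalXU. Qed.

Lemma polyfunD n (h1 h2 : 'rV[K]_n -> K) :
  polyfun h1 -> polyfun h2 -> polyfun (fun v => h1 v + h2 v).
Proof. by move=> [p hp] [q hq]; exists (p + q) => v; rewrite mevalD hp hq. Qed.

Lemma polyfunN n (h : 'rV[K]_n -> K) :
  polyfun h -> polyfun (fun v => - h v).
Proof. by move=> [p hp]; exists (- p) => v; rewrite mevalN hp. Qed.

Lemma polyfunM n (h1 h2 : 'rV[K]_n -> K) :
  polyfun h1 -> polyfun h2 -> polyfun (fun v => h1 v * h2 v).
Proof. by move=> [p hp] [q hq]; exists (p * q) => v; rewrite mevalM hp hq. Qed.

Lemma polyfun_sum n (I : Type) (r : seq I) (h : I -> 'rV[K]_n -> K) :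
  (forall i, polyfun (h i)) -> polyfun (fun v => \sum_(i <- r) h i v).
Proof.
move=> hP; elim: r => [|i r IHr].
  by apply: polyfun_ext (polyfun_cst n 0) => v; rewrite big_nil.
by apply: polyfun_ext (polyfunD (hP i) IHr) => v; rewrite big_cons.
Qed.

Lemma polyfun_comp n m (h : 'rV[K]_m -> K) (k : 'rV[K]_n -> 'rV[K]_m) :
  polyfun h -> polymap k -> polyfun (fun v => h (k v)).
Proof.
move=> [p hp] kP; apply: (@polyfun_ext _ (fun v => p.@[k v 0])) => [v|].
  by rewrite hp.
elim/mpoly_ring_ind: p {hp} => [c|i|p q Pp Pq|p q Pp Pq].
- by apply: polyfun_ext (polyfun_cst n c) => v; rewrite mevalC.
- by apply: polyfun_ext (kP i) => v; rewrite mevalXU.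
- by apply: polyfun_ext (polyfunD Pp Pq) => v; rewrite mevalD.
- by apply: polyfun_ext (polyfunM Pp Pq) => v; rewrite mevalM.
Qed.

Lemma polymap_cst n m (u : 'rV[K]_m) : polymap (fun _ : 'rV[K]_n => u).
Proof. by move=> i; apply: polyfun_cst. Qed.

Lemma polymap_id n : polymap (fun v : 'rV[K]_n => v).
Proof. by move=> i; apply: polyfun_coord. Qed.

Lemma polymapD n m (h1 h2 : 'rV[K]_n -> 'rV[K]_m) :
  polymap h1 -> polymap h2 -> polymap (fun v => h1 v + h2 v).
Proof.
by move=> H1 H2 i; apply: polyfun_ext (polyfunD (H1 i) (H2 i)) => v; rewrite mxE.
Qed.

Lemma polymapN n m (h : 'rV[K]_n -> 'rV[K]_m) :
  polymap h -> polymap (fun v => - h v).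
Proof. by move=> H i; apply: polyfun_ext (polyfunN (H i)) => v; rewrite mxE. Qed.

Lemma polymapZ n m (a : 'rV[K]_n -> K) (h : 'rV[K]_n -> 'rV[K]_m) :
  polyfun a -> polymap h -> polymap (fun v => a v *: h v).
Proof.
by move=> Ha H i; apply: polyfun_ext (polyfunM Ha (H i)) => v; rewrite mxE.
Qed.

Lemma polymap_mulmx n m (M : 'M[K]_(n, m)) : polymap (fun v => v *m M).
Proof.
move=> i.
have: polyfun (fun v : 'rV[K]_n => \sum_j v 0 j * M j i).
  by apply: polyfun_sum => j; apply: polyfunM;
    [apply: polyfun_coord|apply: polyfun_cst].
by apply: polyfun_ext => v; rewrite mxE.
Qed.

Lemma polymap_comp n m l (h : 'rV[K]_m -> 'rV[K]_l) (k : 'rV[K]_n -> 'rV[K]_m) :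
  polymap h -> polymap k -> polymap (fun v => h (k v)).
Proof. by move=> H1 H2 i; apply: polyfun_comp (H1 i) H2. Qed.

Lemma polymap_peval n m (f : 'I_m -> {mpoly K[n]}) : polymap (peval f).
Proof.
by move=> i; apply: polyfun_ext (polyfun_mpoly (f i)) => v; rewrite mxE.
Qed.

Lemma polymapE n m (h : 'rV[K]_n -> 'rV[K]_m) :
  polymap h -> exists f : 'I_m -> {mpoly K[n]}, h =1 peval f.
Proof.
move=> H; have /fin_all_exists[f fP] := H.
by exists f => v; apply/rowP => i; rewrite fP mxE.
Qed.

(** * Restriction to lines and planes *)

Lemma polyfun_line n (h : 'rV[K]_n -> K) (a u : 'rV[K]_n) :
  polyfun h -> exists p : {poly K}, forall s, h (a + s *: u) = p.[s].
Proof.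
move=> [p hp]; exists (mmap polyC (fun i => (a 0 i)%:P + 'X * (u 0 i)%:P) p) => s.
rewrite hp -[RHS]/(horner_eval s _) mmap_retract; last first.
  by move=> c; rewrite /= /horner_eval hornerC.
by apply: meval_eq => i; rewrite /= /horner_eval /= !hornerE !mxE.
Qed.

Lemma polyfun_plane n (h : 'rV[K]_n -> K) (a u w : 'rV[K]_n) :
  polyfun h -> exists p : {poly {poly K}},
    forall s t, h (a + s *: u + t *: w) = p.[t%:P].[s].
Proof.
move=> [p hp].
exists (mmap (polyC \o polyC)
  (fun i => ((a 0 i)%:P + 'X * (u 0 i)%:P)%:P + 'X * (w 0 i)%:P%:P) p) => s t.
rewrite hp -[RHS]/((horner_eval s \o horner_eval t%:P) _) mmap_retract.
  by apply: meval_eq => i; rewrite /= /horner_eval /= !hornerE !mxE.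
by move=> c; rewrite /= /horner_eval /= !hornerC.
Qed.

(** Two points where the factors do not vanish span a line on which the
question is about polynomials in one variable. *)
Lemma polyfun_nonzeroM n (h1 h2 : 'rV[K]_n -> K) :
  polyfun h1 -> polyfun h2 -> (exists v, h1 v != 0) -> (exists v, h2 v != 0) ->
  exists v, h1 v * h2 v != 0.
Proof.
move=> P1 P2 [a h1a] [b h2b].
have [p1 E1] := polyfun_line a (b - a) P1.
have [p2 E2] := polyfun_line a (b - a) P2.
have p1_0 : p1 != 0.
  by apply: contraNneq h1a => p0; have := E1 0; rewrite scale0r addr0 p0 horner0 => ->.
have p2_0 : p2 != 0.
  apply: contraNneq h2b => p0; have := E2 1.
  by rewrite scale1r addrC subrK p0 horner0 => ->.
have [s] := poly_nonroot (mulf_neq0 p1_0 p2_0).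
by rewrite hornerM -E1 -E2; exists (a + s *: (b - a)).
Qed.

Lemma polyfun_domain n (h1 h2 : 'rV[K]_n -> K) :
  polyfun h1 -> polyfun h2 -> (forall v, h1 v * h2 v = 0) ->
  (exists v, h1 v != 0) -> forall v, h2 v = 0.
Proof.
move=> P1 P2 h12 h1nz b; apply/eqP/negPn/negP => h2b.
have [v] := polyfun_nonzeroM P1 P2 h1nz (ex_intro _ b h2b).
by rewrite h12 eqxx.
Qed.

(** * Directional derivatives *)

Definition dird n (p : {mpoly K[n]}) (x u : 'rV[K]_n) : K :=
  \sum_i u 0 i * (p^`M(i)).@[x 0].

Lemma dird_linear n (p : {mpoly K[n]}) x c u w :
  dird p x (c *: u + w) = c * dird p x u + dird p x w.
Proof.
rewrite /dird mulr_sumr -big_split; apply: eq_bigr => i _ /=.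
by rewrite !mxE mulrDl mulrA.
Qed.

Lemma polyfun_dird n m (p : {mpoly K[n]}) (x u : 'rV[K]_m -> 'rV[K]_n) :
  polymap x -> polymap u -> polyfun (fun y => dird p (x y) (u y)).
Proof.
move=> Px Pu; apply: polyfun_sum => i; apply: polyfunM (Pu i) _.
exact: polyfun_comp (polyfun_mpoly _) Px.
Qed.

Lemma mmap_deriv n (V : 'I_n -> {poly K}) (p : {mpoly K[n]}) :
  (mmap polyC V p)^`() = \sum_i mmap polyC V p^`M(i) * (V i)^`().
Proof.
elim/mpoly_ring_ind: p => [c|j|p q Pp Pq|p q Pp Pq].
- rewrite mmapC derivC big1 // => i _.
  by rewrite mderivC -mpolyC0 mmapC mul0r.
- rewrite mmapX mmap1U (bigD1 j) //= big1 => [|i ij].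
    rewrite mderivX mnmE eqxx mmapZ addr0.
    rewrite (_ : (U_(j) - U_(j))%MM = 0%MM) ?mmapX ?mmap11 ?mulr1 ?mul1r //.
    by apply/mnmP => k; rewrite !mnmE subnn.
  by rewrite mderivX mnmE eq_sym (negbTE ij) scale0r -mpolyC0 mmapC mul0r.
- rewrite mmapD derivD Pp Pq -big_split; apply: eq_bigr => i _ /=.
  by rewrite mderivD mmapD mulrDl.
- rewrite rmorphM derivM Pp Pq mulr_suml mulr_sumr -big_split.
  apply: eq_bigr => i _ /=; rewrite mderivM rmorphD !rmorphM /=; ring.
Qed.

(** Chain rule along a polynomial curve, with the value and the velocity of the
curve at the parameter [0] as the only data. *)
Lemma curve_deriv n (p : {mpoly K[n]}) (V : 'I_n -> {poly K}) (x u : 'rV[K]_n) :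
  (forall i, (V i).[0] = x 0 i) -> (forall i, (V i)^`().[0] = u 0 i) ->
  exists q : {poly K}, [/\ forall s, p.@[fun i => (V i).[s]] = q.[s],
    q.[0] = p.@[x 0] & q^`().[0] = dird p x u].
Proof.
move=> Vx Vu; pose q := mmap polyC V p.
have qE (r : {mpoly K[n]}) s : (mmap polyC V r).[s] = r.@[fun i => (V i).[s]].
  rewrite -[LHS]/(horner_eval s _) mmap_retract; last first.
    by move=> c; rewrite /= /horner_eval hornerC.
  by apply: meval_eq => i.
exists q; split; first by move=> s; rewrite qE.
  by rewrite qE; apply: meval_eq.
rewrite mmap_deriv -[LHS]/(horner_eval 0 _) rmorph_sum; apply: eq_bigr => i _.
rewrite rmorphM /= /horner_eval Vu qE mulrC; congr (_ * _).
exact: meval_eq.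
Qed.

End PolynomialFunctions.

(** * Regular functions on plane curves *)

Section PlaneCurves.
Variable K : closedFieldType.

(** Nullstellensatz in one variable; the ideal is a mere predicate, so the
generator is found by descent on the degree. *)
Lemma poly_ideal1 (J : {poly K} -> Prop) :
  (forall p q, J p -> J q -> J (p + q)) -> (forall p q, J q -> J (p * q)) ->
  (forall x, exists2 p, J p & p.[x] != 0) -> J 1.
Proof.
move=> JD JM JV.
have: exists2 p, J p & p != 0.
  by have [p Jp p0] := JV 0; exists p => //; apply: contraNneq p0 => ->; rewrite horner0.
case=> p; have [n] := ubnP (size p); elim: n p => // n IHn p szp Jp p0.
have [|] := altP (size p =P 1%N).
  move/eqP/size_poly1P=> [c c0 pc].
  by rewrite -polyC1 -(mulVf c0) polyCM -pc; apply: JM.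
case/closed_rootP => x px; have [q Jq qx] := JV x.
apply: (IHn (q %% p)).
- by rewrite ltnS in szp; apply: leq_trans szp; rewrite ltn_modp.
- rewrite (_ : q %% p = q + (- (q %/ p)) * p); first by apply: JD Jq (JM _ _ Jp).
  by rewrite {2}(divp_eq q p); ring.
- apply: contraNneq qx => qp0; rewrite (divp_eq q p) qp0 addr0 hornerM.
  by rewrite (rootP px) mulr0.
Qed.

Lemma map_horner (P : {poly {poly K}}) x z :
  (map_poly (horner_eval x) P).[z] = P.[z%:P].[x].
Proof. by rewrite -[RHS]/(horner_eval x _) -horner_map /= /horner_eval hornerC. Qed.

Lemma resultant_horner (P Q : {poly {poly K}}) x :
  P \is monic -> Q \is monic ->
  ((resultant P Q).[x] != 0) =
  coprimep (map_poly (horner_eval x) P) (map_poly (horner_eval x) Q).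
Proof.
move=> mP mQ; pose p := map_poly (horner_eval x) P.
pose q := map_poly (horner_eval x) Q.
have -> : (resultant P Q).[x] = resultant p q.
  by apply: (map_resultant (f := horner_eval x));
    rewrite ?(eqP mP) ?(eqP mQ) rmorph1 oner_eq0.
rewrite resultant_eq0 -leqNgt /coprimep -/p -/q.
have : size (gcdp p q) != 0%N.
  by rewrite size_poly_eq0 gcdp_eq0 negb_and orbC monic_neq0 ?monic_map.
by case: (size _) => [|[]].
Qed.

(** A function on a plane curve, finite over the [x]-axis, which is a quotient
of polynomials around every point is a polynomial: its denominators form an
ideal, which by elimination contains a polynomial in [x] alone that does not
vanish at any prescribed abscissa. *)
Lemma regular_on_curve (Psi : {poly {poly K}}) (phi : K -> K -> K) :
  Psi \is monic -> (1 < size Psi)%N ->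
  (forall x0 z0, Psi.[z0%:P].[x0] = 0 -> exists A B : {poly {poly K}},
      B.[z0%:P].[x0] != 0 /\ forall x z, Psi.[z%:P].[x] = 0 ->
        B.[z%:P].[x] * phi x z = A.[z%:P].[x]) ->
  exists2 C : {poly {poly K}}, (size C < size Psi)%N &
    forall x z, Psi.[z%:P].[x] = 0 -> phi x z = C.[z%:P].[x].
Proof.
move=> mPsi szPsi loc.
pose I B := exists A : {poly {poly K}}, forall x z, Psi.[z%:P].[x] = 0 ->
        B.[z%:P].[x] * phi x z = A.[z%:P].[x].
have ID B1 B2 : I B1 -> I B2 -> I (B1 + B2).
  move=> [A1 E1] [A2 E2]; exists (A1 + A2) => x z xz.
  by rewrite !hornerD mulrDl E1 ?E2.
have IM B1 B2 : I B2 -> I (B1 * B2).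
  by move=> [A2 E2]; exists (B1 * A2) => x z xz; rewrite !hornerM -mulrA E2.
have IPsi : I Psi.
  by exists 0 => x z xz; rewrite xz mul0r !horner0.
have: exists A, forall x z, Psi.[z%:P].[x] = 0 -> phi x z = A.[z%:P].[x].
  suff: I 1%:P%:P by move=> [A E]; exists A => x z xz; rewrite -E // !hornerC mul1r.
  apply: (@poly_ideal1 (fun N => I N%:P)).
  - by move=> p q Ip Iq; rewrite polyCD; apply: ID.
  - by move=> p q Iq; rewrite polyCM; apply: IM.
  move=> x0; have [B IB B1]: exists2 B, I B & map_poly (horner_eval x0) B = 1.
    apply: (@poly_ideal1 (fun b => exists2 B, I B & map_poly (horner_eval x0) B = b)).
    - move=> _ _ [B1 I1 <-] [B2 I2 <-]; exists (B1 + B2); first exact: ID.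
      by rewrite rmorphD.
    - move=> c _ [B IB <-]; exists (map_poly polyC c * B); first exact: IM.
      rewrite rmorphM /= -map_poly_comp /=; congr (_ * _).
      by rewrite map_poly_id // => a _; rewrite /= /horner_eval hornerC.
    move=> z; have [xz|xz] := eqVneq Psi.[z%:P].[x0] 0.
      have [A [B [B0 E]]] := loc _ _ xz.
      by exists (map_poly (horner_eval x0) B); [exists B => //; exists A|rewrite map_horner].
    by exists (map_poly (horner_eval x0) Psi); [exists Psi|rewrite map_horner].
  (* [B2] is monic, so that its resultant with [Psi] can be specialized at [x0]. *)
  pose r := Pdiv.Ring.rmodp B Psi.
  pose B2 := r + Psi.
  have Br : B = Pdiv.Ring.rdivp B Psi * Psi + r by apply: Pdiv.RingMonic.rdivp_eq.
  have szr : (size r < size Psi)%N by rewrite Pdiv.Ring.ltn_rmodpN0 // monic_neq0.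
  have IB2 : I B2.
    rewrite (_ : B2 = B + (1 - Pdiv.Ring.rdivp B Psi) * Psi); last first.
      by rewrite {1}Br /B2; ring.
    by apply: ID IB (IM _ _ IPsi).
  have szB2 : size B2 = size Psi by rewrite /B2 addrC size_polyDl.
  have lB2 : lead_coef B2 = lead_coef Psi by rewrite /B2 addrC lead_coefDl.
  have [|//|[u v] /= _ Res] := resultant_in_ideal (p := B2) (q := Psi).
    by rewrite szB2.
  exists (resultant B2 Psi); first by rewrite Res; apply: ID; apply: IM.
  have mB2 : B2 \is monic by rewrite monicE lB2 -monicE.
  rewrite resultant_horner //; apply/negPn/negP => /closed_rootP[z].
  rewrite root_gcd => /andP[/rootP zB /rootP zP].
  have := congr1 (fun b : {poly K} => b.[z]) B1.
  rewrite {1}Br rmorphD rmorphM !hornerE zP mulr0 add0r.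
  move: zB; rewrite rmorphD hornerD zP addr0 => -> /esym/eqP.
  by rewrite oner_eq0.
move=> [A E]; exists (Pdiv.Ring.rmodp A Psi).
  by rewrite Pdiv.Ring.ltn_rmodpN0 // monic_neq0.
move=> x z xz; rewrite E // {1}(Pdiv.RingMonic.rdivp_eq mPsi A).
by rewrite hornerD hornerM hornerD hornerM xz mulr0 add0r.
Qed.


(** [d] is a substitute for the discriminant; adding [Psi] to its derivative
keeps the degree of the second polynomial under specialization of [x]. *)
Lemma separable_fibres (Psi : {poly {poly K}}) x0 :
  Psi \is monic -> (1 < size Psi)%N ->
  separable_poly (map_poly (horner_eval x0) Psi) ->
  exists2 d : {poly K}, d.[x0] != 0 & forall x, d.[x] != 0 ->
    separable_poly (map_poly (horner_eval x) Psi).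
Proof.
move=> mPsi szPsi sep0; pose Q := Psi + Psi^`().
have szD : (size Psi^`() < size Psi)%N by rewrite lt_size_deriv // monic_neq0.
have lQ : lead_coef Q = 1 by rewrite /Q lead_coefDl // (eqP mPsi).
have redE x : (resultant Psi Q).[x] != 0 =
    separable_poly (map_poly (horner_eval x) Psi).
  rewrite resultant_horner // ?monicE ?lQ // separable_poly.unlock /coprimep.
  by rewrite rmorphD /= -deriv_map (eqp_size (gcdp_addl _ _)).
by exists (resultant Psi Q); [rewrite redE|move=> x; rewrite redE].
Qed.

Lemma separable_fibre_roots (Psi : {poly {poly K}}) x :
  Psi \is monic -> separable_poly (map_poly (horner_eval x) Psi) ->
  exists rs : seq K, [/\ uniq rs, size rs = (size Psi).-1 &
    forall z, z \in rs -> Psi.[z%:P].[x] = 0].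
Proof.
move=> mPsi sep; pose p := map_poly (horner_eval x) Psi.
have mp : p \is monic by apply: monic_map.
have [rs E] := closed_field_poly_normal p.
move: E; rewrite (eqP mp) scale1r => E; exists rs.
have szp : size p = size Psi.
  by rewrite size_map_poly_id0 // (eqP mPsi) rmorph1 oner_eq0.
split; first by rewrite -separable_prod_XsubC -E.
  by rewrite -szp E size_prod_XsubC.
by move=> z; rewrite -root_prod_XsubC -E => /rootP; rewrite map_horner.
Qed.

(** Over almost every [x] the curve has as many points as its degree in [z], too
many for the specialization of [C] at [x]. *)
Lemma vanish_on_curve (Psi C : {poly {poly K}}) x0 :
  Psi \is monic -> (1 < size Psi)%N ->
  separable_poly (map_poly (horner_eval x0) Psi) ->
  (size C < size Psi)%N ->
  (forall x z, Psi.[z%:P].[x] = 0 -> C.[z%:P].[x] = 0) -> C = 0.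
Proof.
move=> mPsi szPsi sep0 szC CV.
have [d d0 dsep] := separable_fibres mPsi szPsi sep0.
apply/polyP => i; rewrite coef0.
suff: d * C`_i = 0.
  move/eqP; rewrite mulf_eq0 => /orP[/eqP dz|/eqP//].
  by move: d0; rewrite dz horner0 eqxx.
apply: poly_fun0 => x; rewrite hornerM.
have [->|dx] := eqVneq d.[x] 0; first by rewrite mul0r.
have [rs [Urs szrs rsP]] := separable_fibre_roots mPsi (dsep _ dx).
have: map_poly (horner_eval x) C = 0.
  apply/eqP/negPn/negP => /max_poly_roots /(_ _ Urs).
  have -> : all (root (map_poly (horner_eval x) C)) rs.
    by apply/allP => z /rsP zP; apply/rootP; rewrite map_horner CV.
  move=> /(_ isT); rewrite szrs => H.
  have := leq_trans H (leq_trans (size_poly _ _) _).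
  move=> /(_ (size Psi).-1); rewrite ltnn => H2.
  by have := H2; rewrite -ltnS prednK ?szC //; [move/(_ isT)|apply: ltnW].
by move/(congr1 (fun p : {poly K} => p`_i)); rewrite coef_map coef0 /= /horner_eval => ->; rewrite mulr0.
Qed.

End PlaneCurves.

(** * Homogeneous forms and cubic expansions *)

Section Forms.
Variable K : closedFieldType.

Lemma dhomog_scale n d (p : {mpoly K[n]}) c (v : 'rV[K]_n) :
  p \is d.-homog -> p.@[(c *: v) 0] = c ^+ d * p.@[v 0].
Proof.
move=> /dhomogP hp; rewrite !mevalE mulr_sumr big_seq [RHS]big_seq.
apply: eq_bigr => m /hp md; rewrite mulrCA; congr (_ * _).
rewrite -md /= mdegE -prodrXr -big_split; apply: eq_bigr => i _.
by rewrite mxE exprMn.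
Qed.

Lemma peval_scale n m d (f : 'I_m -> {mpoly K[n]}) c (v : 'rV[K]_n) :
  (forall i, f i \is d.-homog) -> peval f (c *: v) = c ^+ d *: peval f v.
Proof. by move=> hf; apply/rowP => i; rewrite !mxE (dhomog_scale _ _ (hf i)). Qed.

(** The witness is a homogeneous component; the sum of the others vanishes as a
function, by comparison of the powers of [c]. *)
Lemma dhomog_fun n d (h : 'rV[K]_n -> K) : polyfun h ->
  (forall c v, h (c *: v) = c ^+ d * h v) ->
  exists2 p : {mpoly K[n]}, p \is d.-homog & forall v, h v = p.@[v 0].
Proof.
move=> [p hp] hc; exists (pihomog mdeg d p) => [|v]; first exact: pihomogP.
pose q : {poly K} := \poly_(k < msize p) (pihomog mdeg k p).@[v 0].
have qE c : q.[c] = ((h v)%:P * 'X^d).[c].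
  rewrite !hornerE mulrC -hc hp horner_poly.
  rewrite [in RHS](pihomog_partitionE (mf := mdeg) (leqnn (msize p))) raddf_sum /=.
  by apply: eq_bigr => k _; rewrite (dhomog_scale _ _ (pihomogP _ _ _)) mulrC.
have := congr1 (fun q : {poly K} => q`_d) (poly_fun_inj qE).
rewrite coefCM coefXn eqxx mulr1 coef_poly => <-.
case: ltnP => // szp; suff -> : pihomog mdeg d p = 0 by rewrite meval0.
rewrite pihomogE big_seq_cond big_pred0 // => m.
by apply/negP => /andP[/msize_mdeg_lt + /eqP md]; rewrite md ltnNge szp.
Qed.

Lemma dird_curve n (p : {mpoly K[n]}) (V : 'I_n -> {poly K}) (x u : 'rV[K]_n)
    (r : {poly K}) :
  (forall i, (V i).[0] = x 0 i) -> (forall i, (V i)^`().[0] = u 0 i) ->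
  (forall s, p.@[fun i => (V i).[s]] = r.[s]) -> r^`().[0] = dird p x u.
Proof.
move=> Vx Vu rE; have [q [qE _ <-]] := curve_deriv p Vx Vu.
by congr (_^`().[0]); apply: poly_fun_inj => s; rewrite -rE qE.
Qed.

Lemma dird_line n (p : {mpoly K[n]}) (x u : 'rV[K]_n) (r : {poly K}) :
  (forall s, p.@[(x + s *: u) 0] = r.[s]) -> r^`().[0] = dird p x u.
Proof.
move=> rE; apply: (@dird_curve _ _ (fun i => (x 0 i)%:P + 'X * (u 0 i)%:P)).
- by move=> i; rewrite !hornerE.
- by move=> i; rewrite !derivE !hornerE.
- by move=> s; rewrite -rE; apply: meval_eq => i; rewrite !hornerE !mxE.
Qed.

Lemma dird_euler n d (p : {mpoly K[n]}) (x : 'rV[K]_n) :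
  p \is d.-homog -> dird p x x = d%:R * p.@[x 0].
Proof.
move=> hp; rewrite -(@dird_line _ _ _ _ (('X + 1%:P) ^+ d * (p.@[x 0])%:P)).
  by rewrite !derivE deriv_exp !derivE !hornerE !hornerMn !hornerE expr1n.
by move=> s; rewrite -[X in X + _]scale1r -scalerDl (dhomog_scale _ _ hp)
  !hornerE addrC.
Qed.

Lemma dird_scale n d (p : {mpoly K[n]}) c (x u : 'rV[K]_n) :
  p \is d.-homog -> c * dird p (c *: x) u = c ^+ d * dird p x u.
Proof.
move=> hp; have [r rE] := polyfun_line x u (polyfun_mpoly p).
have -> : c * dird p (c *: x) u = dird p (c *: x) (c *: u).
  by rewrite -[c *: u]addr0 dird_linear /dird [X in _ = _ + X]big1 ?addr0 // => i _;
    rewrite mxE mul0r.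
rewrite -(dird_line rE) -(@dird_line _ _ _ _ (c ^+ d *: r)).
  by rewrite derivZ hornerZ.
by move=> s; rewrite hornerZ -rE -(dhomog_scale _ _ hp) scalerDr !scalerA mulrC.
Qed.

Lemma dirdD n (p q : {mpoly K[n]}) x u :
  dird (p + q) x u = dird p x u + dird q x u.
Proof.
by rewrite -big_split; apply: eq_bigr => i _; rewrite mderivD mevalD mulrDr.
Qed.

Lemma dirdZ n c (p : {mpoly K[n]}) x u : dird (c *: p) x u = c * dird p x u.
Proof.
by rewrite mulr_sumr; apply: eq_bigr => i _; rewrite mderivZ mevalZ mulrCA.
Qed.

Lemma dirdM n (p q : {mpoly K[n]}) x u :
  dird (p * q) x u = dird p x u * q.@[x 0] + p.@[x 0] * dird q x u.
Proof.
rewrite mulr_suml mulr_sumr -big_split; apply: eq_bigr => i _ /=.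
by rewrite mderivM mevalD !mevalM; ring.
Qed.

Lemma dirdX n i (x u : 'rV[K]_n) : dird 'X_i x u = u 0 i.
Proof.
rewrite /dird (bigD1 i) //= big1 => [|j ij]; rewrite mderivX mnmE ?eqxx.
  rewrite (_ : (U_(i) - U_(i))%MM = 0%MM).
    by rewrite scale1r mpolyX0 meval1 mulr1 addr0.
  by apply/mnmP => k; rewrite !mnmE subnn.
by rewrite eq_sym (negbTE ij) scale0r meval0 mulr0.
Qed.

End Forms.

Section Cubics.
Variable K : closedFieldType.

Lemma mdegS n d (m : 'X_{1..n}) : mdeg m = d.+1 ->
  exists i m', m = (U_(i) + m')%MM /\ mdeg m' = d.
Proof.
move=> md; have [i mi] : exists i, m i != 0%N.
  apply/existsP; apply: contraPT md => /existsPn m0.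
  suff -> : m = 0%MM by rewrite mdeg0.
  by apply/mnmP => i; rewrite mnmE; apply/eqP/negPn.
have mE : m = (U_(i) + (m - U_(i)))%MM by rewrite addmC submK // lep1mP.
by exists i, (m - U_(i))%MM; split=> //; move: md; rewrite {1}mE mdegD mdeg1 add1n => -[].
Qed.

(** The trilinear form is not made symmetric, so as to exist in every
characteristic. *)
Definition polar_form n (F : {mpoly K[n]}) (tau : 'rV[K]_n -> 'rV[K]_n -> 'rV[K]_n -> K) :=
  [/\ forall c a a' b d, tau (c *: a + a') b d = c * tau a b d + tau a' b d,
      forall c a b b' d, tau a (c *: b + b') d = c * tau a b d + tau a b' d,
      forall c a b d d', tau a b (c *: d + d') = c * tau a b d + tau a b d',
      forall v, F.@[(v : 'rV[K]_n) 0] = tau v v v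
    & forall v w, dird F v w = tau w v v + tau v w v + tau v v w].

(** This turns all Taylor expansions of cubics into ring identities. *)
Lemma cubic_polar n (F : {mpoly K[n]}) :
  F \is 3.-homog -> exists tau, polar_form F tau.
Proof.
move=> /dhomogP hF; rewrite [F]mpolyE big_seq.
apply: (big_ind (fun G : {mpoly K[n]} => exists tau, polar_form G tau)).
- exists (fun _ _ _ => 0); split=> *; rewrite ?mulr0 ?addr0 ?meval0 //.
  by rewrite /dird big1 // => i _; rewrite mderiv0 meval0 mulr0.
- move=> p q [s [s1 s2 s3 s4 s5]] [t [t1 t2 t3 t4 t5]].
  exists (fun a b d => s a b d + t a b d); split=> *; rewrite ?s1 ?t1 ?s2 ?t2 ?s3 ?t3;
    try ring.
    by rewrite mevalD s4 t4.
  by rewrite dirdD s5 t5; ring.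
move=> m /hF /mdegS[i [m' [-> /mdegS[j [m'' [-> /eqP/mdeg1P[k /eqP->]]]]]]].
move: (F@__) => e; exists (fun a b d => e * (a 0 i * (b 0 j * d 0 k))).
split=> *; rewrite ?mxE; try ring.
  by rewrite mevalZ !mpolyXD !mevalM !mevalXU.
by rewrite dirdZ !mpolyXD !dirdM !mevalM !dirdX !mevalXU; ring.
Qed.

Variables (n : nat) (F : {mpoly K[n]}).
Hypothesis hF : F \is 3.-homog.

Lemma cubic_expand (a b : K) (p q : 'rV[K]_n) : F.@[(a *: p + b *: q) 0] =
  a ^+ 3 * F.@[p 0] + a ^+ 2 * b * dird F p q + a * b ^+ 2 * dird F q p
  + b ^+ 3 * F.@[q 0].
Proof.
have [t [t1 t2 t3 t4 t5]] := cubic_polar hF.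
have z1 y z : t 0 y z = 0.
  by have := t1 (-1) 0 0 y z; rewrite scaler0 addr0 mulN1r addNr.
have z2 x z : t x 0 z = 0.
  by have := t2 (-1) x 0 0 z; rewrite scaler0 addr0 mulN1r addNr.
have z3 x y : t x y 0 = 0.
  by have := t3 (-1) x y 0 0; rewrite scaler0 addr0 mulN1r addNr.
have tl1 c x y z : t (c *: x) y z = c * t x y z.
  by rewrite -[c *: x]addr0 t1 z1 addr0.
have tl2 c x y z : t x (c *: y) z = c * t x y z.
  by rewrite -[c *: y]addr0 t2 z2 addr0.
have tl3 c x y z : t x y (c *: z) = c * t x y z.
  by rewrite -[c *: z]addr0 t3 z3 addr0.
by rewrite !t4 !t5 !(t1, t2, t3, tl1, tl2, tl3); ring.
Qed.

End Cubics.

(** * Determinants of four vectors *)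

Section Det4.
Variable K : fieldType.
Implicit Types a b c d v : 'rV[K]_4.

Definition rows4 a b c d : 'M[K]_4 := \matrix_(i < 4) nth 0 [:: a; b; c; d] i.

Definition det4 a b c d : K := \det (rows4 a b c d).

Lemma mulmx_rows4 (k : 'rV[K]_4) a b c d :
  k *m rows4 a b c d = k 0 0 *: a + k 0 1 *: b + k 0 2 *: c + k 0 3 *: d.
Proof.
by rewrite mulmx_sum_row !big_ord_recr big_ord0 /= add0r !rowK /=;
  congr (_ *: _ + _ *: _ + _ *: _ + _ *: _); congr (k _ _); apply/val_inj.
Qed.

Lemma det4E a b c d : let m i j k l :=
    a 0 i * (b 0 j * (c 0 k * d 0 l - c 0 l * d 0 k)
      - b 0 k * (c 0 j * d 0 l - c 0 l * d 0 j)
      + b 0 l * (c 0 j * d 0 k - c 0 k * d 0 j)) in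
  det4 a b c d = m 0 1 2 3 - m 1 0 2 3 + m 2 0 1 3 - m 3 0 1 2.
Proof.
rewrite /det4 (expand_det_row _ ord0) !big_ord_recr big_ord0 /= add0r.
rewrite /cofactor !(expand_det_row _ ord0) !big_ord_recr !big_ord0 /= !add0r.
rewrite /cofactor !(expand_det_row _ ord0) !big_ord_recr !big_ord0 /= !add0r.
rewrite /cofactor !det_mx11 !mxE /=.
have [f E] : exists f : 'rV[K]_4 -> nat -> K, forall (x : 'rV[K]_4) i, x 0 i = f x i.
  by exists (fun x k => x 0 (inord k)) => x i; rewrite inord_val.
rewrite !E /=.
ring.
Qed.

Lemma det4_span a b c d v : det4 a b c d != 0 ->
  exists k : 'rV[K]_4, v = k 0 0 *: a + k 0 1 *: b + k 0 2 *: c + k 0 3 *: d.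
Proof.
rewrite -unitfE -unitmxE => U; exists (v *m invmx (rows4 a b c d)).
by rewrite -mulmx_rows4 mulmxKV.
Qed.

Lemma det4_free a b c d :
  (forall k : 'rV[K]_4,
     k 0 0 *: a + k 0 1 *: b + k 0 2 *: c + k 0 3 *: d = 0 -> k = 0) ->
  det4 a b c d != 0.
Proof.
move=> H; apply/det0P => -[k k0 /eqP]; rewrite mulmx_rows4 => /eqP /H kE.
by rewrite kE eqxx in k0.
Qed.

Lemma det4_indep a b c d k0 k1 k2 k3 : det4 a b c d != 0 ->
  k0 *: a + k1 *: b + k2 *: c + k3 *: d = 0 ->
  [/\ k0 = 0, k1 = 0, k2 = 0 & k3 = 0].
Proof.
move=> D0 E.
have E0 : k0 * det4 a b c d = 0.
  transitivity (det4 (k0 *: a + k1 *: b + k2 *: c + k3 *: d) b c d).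
    by rewrite !det4E !mxE; ring.
  by rewrite E det4E !mxE; ring.
have E1 : k1 * det4 a b c d = 0.
  transitivity (det4 a (k0 *: a + k1 *: b + k2 *: c + k3 *: d) c d).
    by rewrite !det4E !mxE; ring.
  by rewrite E det4E !mxE; ring.
have E2 : k2 * det4 a b c d = 0.
  transitivity (det4 a b (k0 *: a + k1 *: b + k2 *: c + k3 *: d) d).
    by rewrite !det4E !mxE; ring.
  by rewrite E det4E !mxE; ring.
have E3 : k3 * det4 a b c d = 0.
  transitivity (det4 a b c (k0 *: a + k1 *: b + k2 *: c + k3 *: d)).
    by rewrite !det4E !mxE; ring.
  by rewrite E det4E !mxE; ring.
by split; apply: (mulIf D0); rewrite mul0r.
Qed.

Lemma det4_change a b c d e0 e1 e2 f0 f1 f2 :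
  det4 a (e0 *: a + e1 *: b + e2 *: c) (f0 *: a + f1 *: b + f2 *: c) d =
  (e1 * f2 - e2 * f1) * det4 a b c d.
Proof. by rewrite !det4E !mxE; ring. Qed.

Lemma det4_shear a b c d e f g :
  det4 a (e *: b - f *: d) (e *: c - g *: d) d = e ^+ 2 * det4 a b c d.
Proof. by rewrite !det4E !mxE; ring. Qed.

Lemma det4_scale a b c d x y z :
  det4 (x *: a) (y *: b) (z *: c) d = x * y * z * det4 a b c d.
Proof. by rewrite !det4E !mxE; ring. Qed.

Lemma det4_scale1 a b c d x : det4 (x *: a) b c d = x * det4 a b c d.
Proof. by rewrite !det4E !mxE; ring. Qed.

Lemma det4_lastD a b c d d' x y :
  det4 a b c (x *: d + y *: d') = x * det4 a b c d + y * det4 a b c d'.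
Proof. by rewrite !det4E !mxE; ring. Qed.

Variable D : 'rV[K]_4 -> K.
Hypothesis linD : forall (e : K) u w, D (e *: u + w) = e * D u + D w.

Lemma lin0 : D 0 = 0.
Proof. by have := linD (-1) 0 0; rewrite scaler0 addr0 mulN1r addNr. Qed.

Lemma linZ (e : K) u : D (e *: u) = e * D u.
Proof. by rewrite -[e *: u]addr0 linD lin0 addr0. Qed.

Lemma linDD u w : D (u + w) = D u + D w.
Proof. by rewrite -[u]scale1r linD mul1r scale1r. Qed.

Lemma det4_kernel a b c d w :
  D a = 0 -> D b = 0 -> D c = 0 -> D d = 0 -> D w != 0 -> det4 a b c d = 0.
Proof.
move=> Da Db Dc Dd Dw; apply/eqP; apply: contraNT Dw.
move=> /(det4_span w)[k ->]; rewrite !linDD !linZ Da Db Dc Dd.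
by rewrite !mulr0 !addr0.
Qed.

(** For [u] and [v] in the kernel of [D], the functional [det4 x u v] is
proportional to [D]; the ratio is the invariant two-form of the cone. *)
Lemma det4_proportional x a b w w' : D x = 0 -> D a = 0 -> D b = 0 ->
  D w' != 0 -> det4 x a b w * D w' = det4 x a b w' * D w.
Proof.
move=> Dx Da Db Dw'; apply/eqP; rewrite -subr_eq0 -mulNr mulrC -[in X in _ + X]mulrC.
have := @det4_kernel x a b (D w' *: w + (- D w) *: w') w' Dx Da Db _ Dw'.
rewrite linDD !linZ det4_lastD => <-; first by apply/eqP; ring.
by rewrite mulNr mulrC subrr.
Qed.

(** Otherwise [x] and [w], having zero minors, would be proportional, but only [x]
is killed by [D]. *)
Lemma tangent_frame x w : x != 0 -> D x = 0 -> D w != 0 ->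
  exists a b, [/\ D a = 0, D b = 0 & det4 x a b w != 0].
Proof.
move=> x0 Dx Dw.
have [i xi] := row_nz x0.
suff [a [b ab]] : exists a b, det4 x a b w != 0.
  exists (D w *: a - D a *: w), (D w *: b - D b *: w).
  have tang e : D (D w *: e - D e *: w) = 0 by rewrite -scaleNr linDD !linZ; ring.
  by split=> //; rewrite det4_shear mulf_neq0 // expf_neq0.
apply: contrapT => /forallNP H0; have H a b : det4 x a b w = 0.
  by apply/eqP/negPn/negP => ab; apply: (H0 a); exists b.
have E (i' j' : 'I_4) := H (delta_mx 0 i') (delta_mx 0 j').
have e01 : x 0 0 * w 0 1 - x 0 1 * w 0 0 = 0.
  by rewrite -(E 2 3) det4E !mxE /=; ring.
have e02 : x 0 0 * w 0 2 - x 0 2 * w 0 0 = 0.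
  by rewrite -[RHS]oppr0 -(E 1 3) det4E !mxE /=; ring.
have e03 : x 0 0 * w 0 3 - x 0 3 * w 0 0 = 0.
  by rewrite -(E 1 2) det4E !mxE /=; ring.
have e12 : x 0 1 * w 0 2 - x 0 2 * w 0 1 = 0.
  by rewrite -(E 0 3) det4E !mxE /=; ring.
have e13 : x 0 1 * w 0 3 - x 0 3 * w 0 1 = 0.
  by rewrite -[RHS]oppr0 -(E 0 2) det4E !mxE /=; ring.
have e23 : x 0 2 * w 0 3 - x 0 3 * w 0 2 = 0.
  by rewrite -(E 0 1) det4E !mxE /=; ring.
have ord4 (P : 'I_4 -> Prop) : P 0 -> P 1 -> P 2 -> P 3 -> forall k, P k.
  move=> P0 P1 P2 P3 [k kP]; case: k kP => [|[|[|[|//]]]] kP.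
  - by rewrite (_ : Ordinal _ = 0) //; apply/val_inj.
  - by rewrite (_ : Ordinal _ = 1) //; apply/val_inj.
  - by rewrite (_ : Ordinal _ = 2) //; apply/val_inj.
  - by rewrite (_ : Ordinal _ = 3) //; apply/val_inj.
have minor (k l : 'I_4) : x 0 k * w 0 l = x 0 l * w 0 k.
  apply/eqP; rewrite -subr_eq0; apply/eqP; move: k l.
  by apply: (ord4) => k; move: k; apply: (ord4); rewrite ?subrr // -opprB ?e01 ?e02 ?e03 ?e12 ?e13 ?e23
    ?oppr0.
have xw : x 0 i *: w = w 0 i *: x.
  by apply/rowP => j; rewrite !mxE minor mulrC.
have := congr1 D xw; rewrite !linZ Dx mulr0 => /eqP.
by rewrite mulf_eq0 (negbTE xi) (negbTE Dw).
Qed.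

End Det4.

(** * Smooth cubic surfaces *)

Section SmoothCubic.
Variables (K : closedFieldType) (F : {mpoly K[4]}).
Hypothesis (smF : smooth_cubic F).
Implicit Types (u v w x p q : 'rV[K]_4) (a b s t : K).

Local Notation dF := (dird F).

(** The affine cone over the surface, without its vertex. *)
Definition cone v : Prop := v != 0 /\ F.@[v 0] = 0.

Lemma cubicF : F \is 3.-homog. Proof. by case: smF. Qed.

Lemma F_scale a v : F.@[(a *: v) 0] = a ^+ 3 * F.@[v 0].
Proof. exact: dhomog_scale cubicF. Qed.

Lemma F0 : F.@[(0 : 'rV[K]_4) 0] = 0.
Proof. by rewrite -(scale0r 0) F_scale expr0n mul0r. Qed.

Lemma coneZ a v : a != 0 -> cone v -> cone (a *: v).
Proof.
move=> a0 [v0 Fv]; split; first by rewrite scaler_eq0 negb_or a0.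
by rewrite F_scale Fv mulr0.
Qed.

Lemma dF_linear v : forall a u w, dF v (a *: u + w) = a * dF v u + dF v w.
Proof. exact: dird_linear. Qed.

Lemma dFD v u w : dF v (u + w) = dF v u + dF v w.
Proof. exact: (linDD (dF_linear v)). Qed.

Lemma dFZ v a u : dF v (a *: u) = a * dF v u.
Proof. exact: (linZ (dF_linear v)). Qed.

Lemma dF_euler v : F.@[v 0] = 0 -> dF v v = 0.
Proof. by move=> Fv; rewrite (dird_euler _ cubicF) Fv mulr0. Qed.

Lemma F_chord a b p q : F.@[p 0] = 0 -> F.@[q 0] = 0 ->
  F.@[(a *: p + b *: q) 0] = a * b * (a * dF p q + b * dF q p).
Proof. by move=> Fp Fq; rewrite (cubic_expand cubicF) Fp Fq; ring. Qed.

Lemma F_tangent s v w : F.@[(v + s *: w) 0] =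
  F.@[v 0] + s * dF v w + s ^+ 2 * dF w v + s ^+ 3 * F.@[w 0].
Proof. by rewrite -[v]scale1r (cubic_expand cubicF) scale1r; ring. Qed.

Lemma dF0 w : dF 0 w = 0.
Proof.
have := F_tangent 1 0 w; rewrite F0 scale1r add0r mul1r (lin0 (dF_linear w)) mulr0 addr0.
by rewrite expr1n mul1r add0r -[LHS]add0r => /addIr.
Qed.

Lemma dF_scale a v w : dF (a *: v) w = a ^+ 2 * dF v w.
Proof.
have [->|a0] := eqVneq a 0; first by rewrite scale0r dF0 expr0n mul0r.
by apply: (mulfI a0); rewrite (dird_scale _ _ _ cubicF); ring.
Qed.

Lemma smooth_dF v : cone v -> exists w, dF v w != 0.
Proof.
case=> v0 Fv; have [i Fi] := smF.2 v v0 Fv; exists (delta_mx 0 i).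
rewrite /dird (bigD1 i) //= big1 => [|j ji]; first by rewrite mxE !eqxx mul1r addr0.
by rewrite mxE eqxx (negbTE ji) mul0r.
Qed.

Hypothesis char2 : 2%:R != 0 :> K.

Lemma poly_X0 (r : {poly K}) : (forall s, s * r.[s] = 0) -> r = 0.
Proof.
move=> H; apply/eqP; have: 'X * r == 0.
  by apply/eqP/poly_fun0 => s; rewrite !hornerE.
by rewrite mulf_eq0 polyX_eq0.
Qed.

(** Otherwise [dF v] times [F] is a square up to a factor, so that [F] vanishes
on the plane [dF v = 0]; the residual quadric then meets this plane in points
where the surface is singular. *)
Lemma transversal_line v : cone v -> exists w,
  [/\ dF v w != 0, F.@[w 0] != 0 & dF w v ^+ 2 - 4%:R * (dF v w * F.@[w 0]) != 0].
Proof.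
move=> cv; have [v0 Fv] := cv; have [w0 Dw0] := smooth_dF cv.
have PD : polyfun (dF v).
  by apply: (@polyfun_dird _ _ _ F (fun=> v) id); [apply: polymap_cst|apply: polymap_id].
have PQ : polyfun (fun w => dF w v).
  by apply: (@polyfun_dird _ _ _ F id (fun=> v)); [apply: polymap_id|apply: polymap_cst].
have PF : polyfun (fun w => F.@[w 0]) by apply: polyfun_mpoly.
have PE : polyfun (fun w => dF w v ^+ 2 - 4%:R * (dF v w * F.@[w 0])).
  apply: polyfunD (polyfunM PQ PQ) (polyfunN _).
  by apply: polyfunM; [apply: polyfun_cst|apply: polyfunM].
have [disc|disc0] := pselect (exists w, dF w v ^+ 2 - 4%:R * (dF v w * F.@[w 0]) != 0).
  have nzF : exists w, F.@[w 0] != 0.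
    have [r rE] := polyfun_line v w0 PF.
    have [|s] := @poly_nonroot _ r; last by rewrite -rE; exists (v + s *: w0).
    apply: contraNneq Dw0 => r0; rewrite -(dird_line rE).
    by rewrite r0 deriv0 horner0.
  have [w] := polyfun_nonzeroM PD (polyfunM PF PE) (ex_intro _ w0 Dw0)
    (polyfun_nonzeroM PF PE nzF disc).
  by rewrite !mulf_eq0 !negb_or => /and3P[]; exists w.
have sq w : dF w v ^+ 2 = 4%:R * (dF v w * F.@[w 0]).
  by apply/eqP; rewrite -subr_eq0; apply/negPn/negP => H; apply: disc0; exists w.
have char4 : 4%:R != 0 :> K by rewrite (natrM _ 2 2) mulf_neq0.
have [t [t1 t2 t3 t4 t5]] := cubic_polar cubicF.
pose l u := t v w0 u + t v u w0 + t w0 v u + t u v w0 + t w0 u v + t u w0 v.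
have lE s u : dF (u + s *: w0) v = dF u v + s * l u + s ^+ 2 * dF w0 v.
  by rewrite [u + _]addrC !t5 !(t1, t2, t3) /l; ring.
have lin_l (e : K) x y : l (e *: x + y) = e * l x + l y.
  by rewrite /l !(t1, t2, t3); ring.
have Q0 u : dF v u = 0 -> dF u v = 0.
  by move=> Du; apply/eqP; rewrite -sqrf_eq0 sq Du mul0r mulr0.
have key u : dF v u = 0 -> F.@[u 0] = 0 /\ 4%:R * (dF v w0 * dF u w0) = l u ^+ 2.
  move=> Du.
  have E s : s * (4%:R * dF v w0 * (F.@[u 0] + s * dF u w0 + s ^+ 2 * dF w0 u
      + s ^+ 3 * F.@[w0 0]) - s * (l u + s * dF w0 v) ^+ 2) = 0.
    apply/eqP; rewrite -F_tangent mulrBr subr_eq0; apply/eqP.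
    transitivity (4%:R * (dF v (u + s *: w0) * F.@[(u + s *: w0) 0])).
      by rewrite dFD dFZ Du; ring.
    by rewrite -sq lE (Q0 u Du); ring.
  pose r1 : {poly K} := (4%:R * dF v w0 * dF u w0)%:P + 'X * (4%:R * dF v w0 * dF w0 u)%:P
    + 'X^2 * (4%:R * dF v w0 * F.@[w0 0])%:P - ((l u)%:P + 'X * (dF w0 v)%:P) ^+ 2.
  pose r0 : {poly K} := (4%:R * dF v w0 * F.@[u 0])%:P + 'X * r1.
  have r00 : r0 = 0 by apply: poly_X0 => s; rewrite -[RHS](E s) /r0 /r1 !hornerE /=; ring.
  have Fu : F.@[u 0] = 0.
    have := congr1 (fun r : {poly K} => r.[0]) r00; rewrite /r0 !hornerE => /eqP.
    by rewrite !mulf_eq0 (negbTE Dw0) (negbTE char4) => /eqP.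
  split=> //; have r10 : r1 = 0.
    apply: poly_X0 => s; have := congr1 (fun r : {poly K} => r.[s]) r00.
    by rewrite /r0 Fu mulr0 add0r !hornerE.
  have := congr1 (fun r : {poly K} => r.[0]) r10.
  rewrite /r1 !hornerE /= expr0n /= !mul0r !addr0 => /eqP.
  by rewrite subr_eq0 -mulrA => /eqP.
have dFu u k : dF v u = 0 -> dF v k = 0 -> dF u k = 0.
  move=> Du Dk.
  have E s : s * dF u k + s ^+ 2 * dF k u = 0.
    have Fus : F.@[(u + s *: k) 0] = 0.
      by apply: (key _ _).1; rewrite dFD dFZ Du Dk mulr0 addr0.
    by have := F_tangent s u k; rewrite Fus (key u Du).1 (key k Dk).1 mulr0 addr0 add0r.
  apply: (mulfI char2); rewrite mulr0 -[RHS]subr0 -{1}(E 1) -(E (-1)); ring.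
(* The functional [l] has a zero on the tangent plane, spanned by [v], [a] and [b]. *)
have [u [u0 Du lu]] : exists u, [/\ u != 0, dF v u = 0 & l u = 0].
  have Dv := dF_euler Fv.
  have [a [b [Da Db ab]]] := tangent_frame (dF_linear v) v0 Dv Dw0.
  have [lv|lv] := eqVneq (l v) 0; first by exists v.
  exists (l a *: v + (- l v) *: a); split.
  - apply: contraNneq ab => av.
    have -> : a = (l a / l v) *: v.
      apply: (scalerI lv); rewrite scalerA mulrCA divff // mulr1.
      by apply/eqP; rewrite eq_sym -subr_eq0 -scaleNr av.
    by rewrite !det4E !mxE; apply/eqP; ring.
  - by rewrite dFD !dFZ Dv Da !mulr0 addr0.
  - by rewrite (linDD lin_l) !(linZ lin_l); ring.
have [Fu /eqP] := key u Du; rewrite lu expr0n /= !mulf_eq0 (negbTE char4) (negbTE Dw0) /=.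
move/eqP => duw0; have [w] := smooth_dF (conj u0 Fu).
rewrite (_ : w = (dF v w / dF v w0) *: w0 + (w - (dF v w / dF v w0) *: w0)); last first.
  by rewrite addrC subrK.
rewrite dFD dFZ duw0 mulr0 add0r dFu ?eqxx // -scaleNr dFD dFZ mulNr divfK ?subrr //.
Qed.

End SmoothCubic.

(** * Tangential derivatives along the cone *)

Section Chords.
Variables (K : closedFieldType) (F : {mpoly K[4]}).
Hypotheses (smF : smooth_cubic F) (char2 : 2%:R != 0 :> K).
Implicit Types (u v w x p q : 'rV[K]_4) (a b s t : K).
Local Notation dF := (dird F).
Local Notation cone := (cone F).

Lemma three_points x : cone x -> exists w t1 t2,
  [/\ F.@[w 0] != 0, dF x w != 0, [&& t1 != 0, t2 != 0 & t1 != t2] &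
   forall t, F.@[(x + t *: w) 0] = F.@[w 0] * (t * (t - t1) * (t - t2))].
Proof.
move=> cx; have [w [Dw Fw disc]] := transversal_line smF char2 cx.
have [x0 Fx] := cx.
have [d dE] : exists d, d ^+ 2 = dF w x ^+ 2 - 4%:R * (dF x w * F.@[w 0]).
  set e := _ - _; have /closed_rootP[d] : size ('X^2 - e%:P) != 1%N.
    by rewrite size_XnsubC.
  by rewrite rootE !hornerE subr_eq0 => /eqP; exists d.
have d0 : d != 0 by rewrite -sqrf_eq0 dE.
pose t1 := (- dF w x + d) / (2%:R * F.@[w 0]).
pose t2 := (- dF w x - d) / (2%:R * F.@[w 0]).
have t12 : t1 * t2 = dF x w / F.@[w 0].
  have -> : t1 * t2 = (dF w x ^+ 2 - d ^+ 2) / (4%:R * F.@[w 0] ^+ 2).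
    by rewrite /t1 /t2; field; rewrite char2 Fw (natrM _ 2 2) mulf_neq0.
  by rewrite dE; field; rewrite Fw (natrM _ 2 2) mulf_neq0.
exists w, t1, t2; split=> //.
  have : t1 * t2 != 0 by rewrite t12 mulf_neq0 ?invr_eq0.
  rewrite mulf_eq0 negb_or => /andP[-> ->] /=.
  rewrite -subr_eq0 (_ : t1 - t2 = d / F.@[w 0]) ?mulf_neq0 ?invr_eq0 //.
  by rewrite /t1 /t2; field; rewrite char2 Fw.
move=> t; rewrite (F_tangent smF) Fx.
have -> : F.@[w 0] * (t * (t - t1) * (t - t2)) =
   F.@[w 0] * t ^+ 3 - t ^+ 2 * (F.@[w 0] * (t1 + t2)) + t * F.@[w 0] * (t1 * t2) by ring.
rewrite t12 (_ : F.@[w 0] * (t1 + t2) = - dF w x).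
  by field; rewrite Fw.
by rewrite /t1 /t2; field; rewrite char2 Fw.
Qed.

(** A plane section of the cone, as a curve finite over the [s]-axis. *)
Lemma cubic_curve x u w : F.@[w 0] != 0 -> exists Psi : {poly {poly K}},
  [/\ Psi \is monic, size Psi = 4%N &
   forall s t, Psi.[t%:P].[s] = F.@[(x + s *: u + t *: w) 0] / F.@[w 0]].
Proof.
move=> Fw.
have [c0 E0] := polyfun_line x u (polyfun_mpoly F).
have [c1 E1] : exists p : {poly K}, forall s, dF (x + s *: u) w = p.[s].
  apply: (@polyfun_line _ _ (fun y => dF y w)).
  by apply: (@polyfun_dird _ _ _ F id (fun=> w)); [apply: polymap_id|apply: polymap_cst].
have [c2 E2] : exists p : {poly K}, forall s, dF w (x + s *: u) = p.[s].
  apply: (@polyfun_line _ _ (fun y => dF w y)).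
  by apply: (@polyfun_dird _ _ _ F (fun=> w) id); [apply: polymap_cst|apply: polymap_id].
pose r := Poly [:: F.@[w 0]^-1 *: c0; F.@[w 0]^-1 *: c1; F.@[w 0]^-1 *: c2].
have szr : (size r < size ('X^3 : {poly {poly K}}))%N.
  by rewrite size_polyXn ltnS size_Poly.
exists ('X^3 + r); split.
- by rewrite monicE lead_coefDl // lead_coefXn.
- by rewrite size_polyDl // size_polyXn.
move=> s t; rewrite (F_tangent smF) E0 E1 E2 hornerD horner_Poly /= !hornerE /=.
by field.
Qed.

Lemma separable_cubic (Psi : {poly {poly K}}) s t1 t2 t3 :
  uniq [:: t1; t2; t3] ->
  (forall t, Psi.[t%:P].[s] = (t - t1) * (t - t2) * (t - t3)) ->
  separable_poly (map_poly (horner_eval s) Psi).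
Proof.
move=> Ut E.
have -> : map_poly (horner_eval s) Psi = \prod_(t <- [:: t1; t2; t3]) ('X - t%:P).
  apply: poly_fun_inj => t; rewrite map_horner E !big_cons big_nil !hornerE /=; ring.
by rewrite separable_prod_XsubC.
Qed.

(** By continuity along the line spanned by [x]. *)
Lemma vanish_on_cone0 (P : 'rV[K]_4 -> K) x : polyfun P -> cone x ->
  (forall v, cone v -> P v = 0) -> P 0 = 0.
Proof.
move=> hP cx PV; have [r rE] := polyfun_line 0 x hP.
have r0 : 'X * r = 0.
  apply: poly_fun0 => s; rewrite !hornerE -rE add0r.
  have [->|s0] := eqVneq s 0; first by rewrite mul0r.
  by rewrite PV ?mulr0 //; apply: coneZ.
have := rE 0; rewrite scale0r addr0 => ->.
by move/eqP: r0; rewrite mulf_eq0 polyX_eq0 => /eqP ->; rewrite horner0.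
Qed.

(** In a plane containing [x] and the tangent vector, [P] is divisible by the
reduced equation of the cone, whose derivative along [u] vanishes. *)
Lemma tangential_derivative (P : {mpoly K[4]}) x u :
  (forall v, cone v -> P.@[v 0] = 0) -> cone x -> dF x u = 0 -> dird P x u = 0.
Proof.
move=> PV cx Du; have [x0 Fx] := cx.
have [w [t1 [t2 [Fw Dw /and3P[t10 t20 t12] tE]]]] := three_points cx.
have [Psi [mPsi szPsi PsiE]] := cubic_curve x u Fw.
have [Q QE] := polyfun_plane x u w (polyfun_mpoly P).
have szPsi1 : (1 < size Psi)%N by rewrite szPsi.
have sep : separable_poly (map_poly (horner_eval 0) Psi).
  apply: (@separable_cubic _ _ 0 t1 t2) => [|t].
    by rewrite /= !inE negb_or ![0 == _]eq_sym t10 t20 t12.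
  by rewrite PsiE scale0r addr0 tE; field.
have Q0 : Pdiv.Ring.rmodp Q Psi = 0.
  apply: (vanish_on_curve mPsi szPsi1 sep).
    by rewrite Pdiv.Ring.ltn_rmodpN0 // monic_neq0.
  move=> s t Pst; have := QE s t.
  rewrite {1}(Pdiv.RingMonic.rdivp_eq mPsi Q) !hornerD !hornerM Pst mulr0 add0r => <-.
  have [->|v0] := eqVneq (x + s *: u + t *: w) 0.
    exact: (vanish_on_cone0 (polyfun_mpoly P) cx PV).
  apply: PV; split=> //; move: Pst; rewrite PsiE => /eqP.
  by rewrite mulf_eq0 invr_eq0 (negbTE Fw) orbF => /eqP.
have [f fE] := polyfun_line x u (polyfun_mpoly F).
pose q := (Pdiv.Ring.rdivp Q Psi).[0%:P] * (F.@[w 0]^-1 *: f).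
rewrite -(@dird_line _ _ _ _ _ q) => [|s].
  rewrite /q derivM derivZ !hornerE (dird_line fE) Du -fE scale0r addr0 Fx.
  by rewrite /= !mulr0 addr0.
have := QE s 0; rewrite scale0r addr0 => ->.
have PsiE0 : Psi.[0%:P].[s] = F.@[w 0]^-1 * f.[s].
  by rewrite PsiE scale0r addr0 fE mulrC.
have {1}-> : Q = Pdiv.Ring.rdivp Q Psi * Psi.
  by rewrite {1}(Pdiv.RingMonic.rdivp_eq mPsi Q) Q0 addr0.
by rewrite !(hornerM, hornerZ) PsiE0.
Qed.

End Chords.

(** * Maps of weight one on chords *)

Section WeightOne.
Variables (K : closedFieldType) (F : {mpoly K[4]}).
Hypotheses (smF : smooth_cubic F) (char2 : 2%:R != 0 :> K).
Implicit Types (u v w x p q : 'rV[K]_4) (a b s t : K).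
Local Notation dF := (dird F).
Local Notation cone := (cone F).

(** Comparison of the two charts of a line: a function of weight [-1] without
poles vanishes. *)
Lemma no_weight_minus1 (a b d : {poly K}) : d != 0 ->
  (forall s, s != 0 -> d.[s] != 0 -> s * a.[s] = b.[s^-1]) -> a = 0.
Proof.
move=> d0 ab; pose n := size b.
pose r : {poly K} := \sum_(k < n) b`_k *: 'X^(n - k).
have szr : (size r <= n.+1)%N.
  apply: leq_trans (size_sum _ _ _) _; apply/bigmax_leqP => k _.
  apply: leq_trans (size_scale_leq _ _) _.
  by rewrite size_polyXn ltnS leq_subr.
have E : ('X * d) * ('X^(n.+1) * a - r) = 0.
  apply: poly_fun0 => s; rewrite hornerM; apply/eqP; rewrite mulf_eq0.
  rewrite hornerM hornerX mulf_eq0.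
  have [//|s0 /=] := eqVneq s 0; have [//|ds /=] := eqVneq d.[s] 0.
  rewrite !hornerE exprSr -mulrA ab // /r horner_sum horner_coef mulr_sumr.
  rewrite subr_eq0; apply/eqP; apply: eq_bigr => k _.
  rewrite hornerZ hornerXn exprVn mulrCA; congr (_ * _).
  have -> : s ^+ n = s ^+ (n - k) * s ^+ k by rewrite -exprD subnK // ltnW.
  by rewrite mulfK // expf_neq0.
apply/eqP/negPn/negP => a0.
move/eqP: E; rewrite !mulf_eq0 polyX_eq0 (negbTE d0) /= subr_eq0 => /eqP rE.
have := szr; rewrite -rE size_monicM ?monicXn // size_polyXn addSn /=.
by rewrite -[X in (_ <= X)%N]addn0 leq_add2l leqn0 size_poly_eq0 (negbTE a0).
Qed.

(** Such a map is a global section of four copies of the sheaf O(1) on the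
surface. *)
Definition regular_weight1 (g : 'rV[K]_4 -> 'rV[K]_4) : Prop :=
  (forall x0, cone x0 -> exists (A : 'rV[K]_4 -> 'rV[K]_4) (B : 'rV[K]_4 -> K),
     [/\ polymap A, polyfun B, B x0 != 0 & forall x, cone x -> B x *: g x = A x])
  /\ (forall a x, a != 0 -> cone x -> g (a *: x) = a *: g x).

(** A plane section is a plane curve, to which [regular_on_curve] applies. *)
Lemma section_regular g x u w i : regular_weight1 g -> F.@[w 0] != 0 ->
  (forall s t, x + s *: u + t *: w != 0) ->
  exists Psi C : {poly {poly K}},
  [/\ Psi \is monic, size Psi = 4%N, (size C < 4)%N,
   forall s t, Psi.[t%:P].[s] = F.@[(x + s *: u + t *: w) 0] / F.@[w 0]
   & forall s t, Psi.[t%:P].[s] = 0 ->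
     g (x + s *: u + t *: w) 0 i = C.[t%:P].[s]].
Proof.
move=> [gloc _] Fw nz; have [Psi [mPsi szPsi PsiE]] := cubic_curve smF x u Fw.
have on_cone s t : Psi.[t%:P].[s] = 0 -> cone (x + s *: u + t *: w).
  rewrite PsiE => /eqP; rewrite mulf_eq0 invr_eq0 (negbTE Fw) orbF => /eqP E.
  by split.
have szPsi1 : (1 < size Psi)%N by rewrite szPsi.
have [|C szC CE] := @regular_on_curve _ Psi (fun s t => g (x + s *: u + t *: w) 0 i)
    mPsi szPsi1.
  move=> s0 t0 /on_cone /gloc[A [B [PA PB B0 AB]]].
  have [a aE] := polyfun_plane x u w (PA i).
  have [b bE] := polyfun_plane x u w PB.
  exists a, b; rewrite -bE; split=> // s t /on_cone st.
  by rewrite -bE -aE -AB // mxE.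
by exists Psi, C; rewrite szPsi in szC.
Qed.

Lemma horner_size4 (C : {poly {poly K}}) s t : (size C < 4)%N ->
  C.[t%:P].[s] = (C`_0).[s] + t * (C`_1).[s] + t ^+ 2 * (C`_2).[s].
Proof.
rewrite ltnS => szC; rewrite (horner_coef_wide _ szC) !big_ord_recl big_ord0.
by rewrite !hornerE /=; ring.
Qed.

Lemma quadratic_eq a0 a1 a2 b0 b1 b2 (rs : seq K) : uniq rs -> size rs = 3%N ->
  (forall t, t \in rs ->
     a0 + t * a1 + t ^+ 2 * a2 = b0 + t * b1 + t ^+ 2 * b2) -> a2 = b2.
Proof.
move=> Urs szrs E; pose r := Poly [:: a0 - b0; a1 - b1; a2 - b2].
have r0 : r = 0.
  apply/eqP/negPn/negP => /max_poly_roots /(_ _ Urs).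
  have -> : all (root r) rs.
    apply/allP => t /E Et; apply/rootP; rewrite horner_Poly /=.
    rewrite mul0r add0r -(subrr (a0 + t * a1 + t ^+ 2 * a2)) [in X in _ = _ - X]Et; ring.
  by move=> /(_ isT); rewrite szrs ltnNge size_Poly.
have := congr1 (fun r : {poly K} => r`_2) r0; rewrite coef_Poly coef0 /= => /eqP.
by rewrite subr_eq0 => /eqP.
Qed.

(** On the section by the plane of the pencil, seen from the centre [o], [g] is
quadratic in the fibre coordinate [t] with coefficients depending on the line;
weights force the coefficient of [t ^+ 2], which has weight [-1], to vanish.
So [g] is affine on each line of the pencil. *)
Lemma weight1_affine g (y c o : 'rV[K]_4) t1 t2 t3 : regular_weight1 g -> F.@[o 0] != 0 ->
  (forall e1 e2 e3 : K, e1 *: y + e2 *: c + e3 *: o = 0 -> [/\ e1 = 0, e2 = 0 & e3 = 0]) ->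
  uniq [:: t1; t2; t3] ->
  (forall t, F.@[(y + t *: o) 0] = F.@[o 0] * ((t - t1) * (t - t2) * (t - t3))) ->
  exists a0 a1 : 'rV[K]_4, forall t, t \in [:: t1; t2; t3] ->
    g (y + t *: o) = a0 + t *: a1.
Proof.
move=> wg Fo free Ut yo.
suff H i : exists e : K * K, forall t, t \in [:: t1; t2; t3] ->
    g (y + t *: o) 0 i = e.1 + t * e.2.
  have [e eE] := fin_all_exists H.
  exists (\row_i (e i).1), (\row_i (e i).2) => t tt; apply/rowP => i.
  by rewrite eE // !mxE.
have nz1 s t : y + s *: c + t *: o != 0.
  apply/eqP => E; have [] := free 1 s t; first by rewrite scale1r.
  by move/eqP; rewrite oner_eq0.
have nz2 s t : c + s *: y + t *: o != 0.
  apply/eqP => E; have [] := free s 1 t; first by rewrite scale1r [_ + c]addrC.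
  by move=> _ /eqP; rewrite oner_eq0.
have [Psi [C [mPsi szPsi szC PsiE CE]]] := section_regular i wg Fo nz1.
have [Phi [D [mPhi szPhi szD PhiE DE]]] := section_regular i wg Fo nz2.
have sep : separable_poly (map_poly (horner_eval 0) Psi).
  apply: (separable_cubic Ut) => t; rewrite PsiE scale0r addr0 yo; field.
  exact: Fo.
have szPsi1 : (1 < size Psi)%N by rewrite szPsi.
have [d d0 dsep] := separable_fibres mPsi szPsi1 sep.
have C2 : C`_2 = 0.
  apply: (@no_weight_minus1 _ D`_2 d).
    by apply: contraNneq d0 => ->; rewrite horner0.
  move=> s s0 /dsep sep_s.
  have [rs [Urs szrs rsP]] := separable_fibre_roots mPsi sep_s.
  rewrite szPsi in szrs.
  have E t : t \in rs -> (C`_0).[s] + t * (C`_1).[s] + t ^+ 2 * (C`_2).[s] =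
     s * (D`_0).[s^-1] + t * (D`_1).[s^-1] + t ^+ 2 * (s^-1 * (D`_2).[s^-1]).
    move=> /rsP st; have yE : y + s *: c + t *: o = s *: (c + s^-1 *: y + (t / s) *: o).
      by rewrite !scalerDr !scalerA mulfV // scale1r mulrCA mulfV // mulr1 [_ + y]addrC.
    have F0 : F.@[(c + s^-1 *: y + (t / s) *: o) 0] = 0.
      move/eqP: st; rewrite PsiE mulf_eq0 invr_eq0 (negbTE Fo) orbF yE.
      by rewrite (F_scale smF) mulf_eq0 expf_eq0 /= (negbTE s0) => /eqP.
    have cn : cone (c + s^-1 *: y + (t / s) *: o) by split.
    rewrite -horner_size4 // -CE // yE wg.2 //.
    rewrite mxE DE; last by rewrite PhiE F0 mul0r.
    by rewrite horner_size4 //; field.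
  by rewrite (quadratic_eq Urs szrs E) mulrA mulfV // mul1r.
exists ((C`_0).[0], (C`_1).[0]) => t tt.
have Pt : Psi.[t%:P].[0] = 0.
  rewrite PsiE scale0r addr0 yo; move: tt; rewrite !inE => /or3P[]/eqP->;
    by rewrite subrr !(mul0r, mulr0).
have := CE _ _ Pt; rewrite scale0r addr0 => ->.
by rewrite horner_size4 // C2 horner0 mulr0 addr0.
Qed.

(** The centre [o] is taken on the chord, off the surface, so that the chord is a
line of a pencil as in [weight1_affine]. *)
Theorem weight1_chord g p q : regular_weight1 g -> cone p -> cone q ->
  dF p q != 0 -> dF q p != 0 ->
  g (dF q p *: p - dF p q *: q) = dF q p *: g p - dF p q *: g q.
Proof.
move=> wg cp cq A0 B0; set A := dF p q in A0 *; set B := dF q p in B0 *.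
have [p0 Fp] := cp; have [q0 Fq] := cq.
(* The scalar [e] is chosen such that [F] does not vanish at [p + e *: q]. *)
have [e] : exists e, ('X * (A%:P + B *: 'X)).[e] != 0.
  apply: poly_nonroot; rewrite mulf_eq0 polyX_eq0 /=.
  apply: contraNneq B0 => H; have := congr1 (fun r : {poly K} => r`_1) H.
  by rewrite coef0 coefD coefC coefZ coefX /= add0r mulr1 => ->.
rewrite !hornerE mulf_eq0 negb_or => /andP[e0 ABe].
pose o := p + e *: q.
have FpE t : F.@[(p + t *: o) 0] = e * t * (1 + t) * ((1 + t) * A + (e * t) * B).
  have -> : p + t *: o = (1 + t) *: p + (e * t) *: q.
    by rewrite /o scalerDr scalerDl scale1r scalerA addrA mulrC.
  by rewrite (F_chord smF) // -/A -/B; ring.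
have Fo : F.@[o 0] = e * (A + B * e).
  by rewrite /o -[p]scale1r (F_chord smF) // -/A -/B; ring.
have Fo0 : F.@[o 0] != 0 by rewrite Fo mulf_neq0.
have [c [b [_ _ det0]]] := tangent_frame (dF_linear F p) p0 (dF_euler smF Fp) A0.
have free e1 e2 e3 : e1 *: p + e2 *: c + e3 *: o = 0 -> [/\ e1 = 0, e2 = 0 & e3 = 0].
  move=> E; have [|E1 E2 _ E3] := @det4_indep _ p c b q (e1 + e3) e2 0 (e3 * e) det0.
    by rewrite -[RHS]E /o; apply/rowP => j; rewrite !mxE; ring.
  move/eqP: E3; rewrite mulf_eq0 (negbTE e0) orbF => /eqP e30.
  by move: E1; rewrite e30 addr0.
(* The chord meets the surface at the parameters [0], [-1] and [t3], which are
   those of [p], [q] and the residual point. *)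
pose t3 := - A / (A + B * e).
have Ut : uniq [:: 0; -1; t3].
  have t30 : t3 != 0 by rewrite /t3 mulf_neq0 ?oppr_eq0 ?invr_eq0.
  have t31 : t3 + 1 != 0.
    have -> : t3 + 1 = B * e / (A + B * e) by rewrite /t3; field.
    by rewrite !mulf_neq0 ?invr_eq0.
  by rewrite /= !inE negb_or ![_ == t3]eq_sym -[t3 == -1]addr_eq0 t30 t31
    eq_sym oppr_eq0 oner_eq0.
have [|a0 [a1 aE]] := weight1_affine wg Fo0 free Ut.
  by move=> t; rewrite FpE Fo /t3; field.
have gp : g p = a0.
  by have := aE 0; rewrite !inE eqxx !scale0r !addr0 => ->.
have gq : - e *: g q = a0 - a1.
  have := aE (-1); rewrite !inE eqxx orbT !scaleN1r => <- //.
  rewrite (_ : p - o = - e *: q) ?wg.2 ?oppr_eq0 //.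
  by rewrite /o opprD addNKr scaleNr.
have gr := aE t3; rewrite !inE eqxx !orbT in gr.
have rE : B *: p - A *: q = ((A + B * e) / e) *: (p + t3 *: o).
  by apply/rowP => j; rewrite /o /t3 !mxE; field; rewrite e0 ABe.
have cr : cone (p + t3 *: o).
  split; last by rewrite FpE /t3; field.
  apply/eqP => E; have [] := free 1 0 t3; first by rewrite scale1r scale0r addr0.
  by move/eqP; rewrite oner_eq0.
rewrite rE wg.2 ?mulf_neq0 ?invr_eq0 // gr // gp.
have -> : g q = - e^-1 *: (a0 - a1).
  by rewrite -gq scalerA mulrNN mulVf // scale1r.
apply/rowP => j; rewrite !mxE /t3; field.
by rewrite e0 ABe.
Qed.

End WeightOne.

(** * Differentials of maps between cones *)

Section Colinear.
Variable K : closedFieldType.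

Definition colinear (x y : 'rV[K]_4) : Prop := forall i j, x 0 i * y 0 j = x 0 j * y 0 i.

Lemma colinearP (x y : 'rV[K]_4) : x != 0 -> colinear x y -> exists c, y = c *: x.
Proof.
move=> x0 xy; have [i xi] := row_nz x0.
exists (y 0 i / x 0 i); apply/rowP => j; rewrite mxE.
by apply: (mulfI xi); rewrite xy; field.
Qed.

Lemma colinearZ a (x : 'rV[K]_4) : colinear x (a *: x).
Proof. by move=> i j; rewrite !mxE; ring. Qed.

Lemma colinear0 (x : 'rV[K]_4) : colinear x 0.
Proof. by move=> i j; rewrite !mxE !mulr0. Qed.

Lemma colinear_sym (x y : 'rV[K]_4) : colinear x y -> colinear y x.
Proof. by move=> xy i j; rewrite mulrC -xy mulrC. Qed.

Definition diffl n m (f : 'I_m -> {mpoly K[n]}) (x u : 'rV[K]_n) : 'rV[K]_m :=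
  \row_i dird (f i) x u.

Lemma diffl_linear n m (f : 'I_m -> {mpoly K[n]}) x : forall a u w,
  diffl f x (a *: u + w) = a *: diffl f x u + diffl f x w.
Proof. by move=> a u w; apply/rowP => i; rewrite !mxE dird_linear. Qed.

Lemma diffl0 n m (f : 'I_m -> {mpoly K[n]}) x : diffl f x 0 = 0.
Proof.
by have := diffl_linear f x (-1) 0 0; rewrite scaler0 addr0 scaleN1r addNr.
Qed.

Lemma difflZ n m (f : 'I_m -> {mpoly K[n]}) x a u :
  diffl f x (a *: u) = a *: diffl f x u.
Proof. by rewrite -[a *: u]addr0 diffl_linear diffl0 addr0. Qed.

Lemma difflD n m (f : 'I_m -> {mpoly K[n]}) x u w :
  diffl f x (u + w) = diffl f x u + diffl f x w.
Proof. by rewrite -[u]scale1r diffl_linear !scale1r. Qed.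

Lemma diffl_euler n m d (f : 'I_m -> {mpoly K[n]}) x :
  (forall i, f i \is d.-homog) -> diffl f x x = d%:R *: peval f x.
Proof. by move=> hf; apply/rowP => i; rewrite !mxE (dird_euler _ (hf i)). Qed.

Lemma polymap_diffl n m l (f : 'I_m -> {mpoly K[n]}) (x u : 'rV[K]_l -> 'rV[K]_n) :
  polymap x -> polymap u -> polymap (fun y => diffl f (x y) (u y)).
Proof.
by move=> Px Pu i; apply: polyfun_ext (polyfun_dird (f i) Px Pu) => y; rewrite mxE.
Qed.

Lemma dird_comp n m (p : {mpoly K[m]}) (f : 'I_m -> {mpoly K[n]}) :
  exists q : {mpoly K[n]}, (forall v : 'rV[K]_n, q.@[v 0] = p.@[(peval f v) 0]) /\
    forall x u, dird q x u = dird p (peval f x) (diffl f x u).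
Proof.
have [q qE] := polyfun_comp (polyfun_mpoly p) (polymap_peval f).
exists q; split=> [v|x u]; first by rewrite qE.
have [r rE] := polyfun_line x u (polyfun_mpoly q).
rewrite -(dird_line rE).
have /fin_all_exists[V VE] i := polyfun_line x u (polyfun_mpoly (f i)).
apply: (@dird_curve _ _ _ V) => [i|i|s].
- by rewrite -VE scale0r addr0 mxE.
- by rewrite (dird_line (VE i)) mxE.
- by rewrite -rE -qE; apply: meval_eq => i; rewrite -VE mxE.
Qed.

Lemma polyfun_det4 n (a b c d : 'rV[K]_n -> 'rV[K]_4) :
  polymap a -> polymap b -> polymap c -> polymap d ->
  polyfun (fun y => det4 (a y) (b y) (c y) (d y)).
Proof.
move=> Pa Pb Pc Pd.
apply: (polyfun_ext (fun y => esym (det4E (a y) (b y) (c y) (d y)))).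
by do !first [apply: polyfunD | apply: polyfunN | apply: polyfunM | done].
Qed.

End Colinear.

(** * The Jacobian lift of an automorphism *)

Section Jacobian.
Variables (K : closedFieldType) (F : {mpoly K[4]}).
Hypotheses (smF : smooth_cubic F) (char2 : 2%:R != 0 :> K).
Implicit Types (u v w x y p q : 'rV[K]_4) (a b c s t : K) (f e : 'I_4 -> {mpoly K[4]}).
Local Notation dF := (dird F).
Local Notation cone := (cone F).

(** The two-by-two minors of [f] and [e] vanish on the cone; their tangential
derivatives give the relation, by the Leibniz rule. *)
Lemma colinear_diffl f e x u c : (forall y, cone y -> colinear (peval f y) (peval e y)) ->
  cone x -> dF x u = 0 -> peval f x != 0 -> peval e x = c *: peval f x ->
  exists b, diffl e x u = c *: diffl f x u + b *: peval f x.
Proof.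
move=> fe cx Du fx ex.
have [b bE] : exists b, diffl e x u - c *: diffl f x u = b *: peval f x.
  apply: (colinearP fx) => i j.
  have : dird (f i * e j - f j * e i) x u = 0.
    apply: (tangential_derivative smF char2 _ cx Du) => v /fe H.
    by have := H i j; rewrite !mxE mevalB !mevalM => ->; rewrite subrr.
  have eE k : (e k).@[x 0] = c * (f k).@[x 0].
    by have := congr1 (fun v : 'rV[K]_4 => v 0 k) ex; rewrite !mxE.
  rewrite -scaleN1r dirdD dirdZ !dirdM !eE !mxE => H.
  by apply/eqP; rewrite -subr_eq0 -[X in _ == X]H; apply/eqP; ring.
by exists b; rewrite -bE addrC subrK.
Qed.

Definition represents (phi : 'rV[K]_4 -> 'rV[K]_4) d f : Prop :=
  (forall i, f i \is d.-homog) /\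
  forall x, cone x -> peval f x != 0 -> exists2 c, c != 0 & phi x = c *: peval f x.

Definition regular_lift (phi : 'rV[K]_4 -> 'rV[K]_4) : Prop :=
  (forall x, cone x -> cone (phi x)) /\
  forall x, cone x -> exists d f, represents phi d f /\ peval f x != 0.

Section Lift.
Variables phi psi : 'rV[K]_4 -> 'rV[K]_4.
Hypotheses (phiR : regular_lift phi) (psiR : regular_lift psi).
Hypothesis phiK : forall x, cone x -> exists2 c, c != 0 & psi (phi x) = c *: x.

Lemma represents_cone d f x : represents phi d f -> cone x -> peval f x != 0 ->
  cone (peval f x).
Proof.
move=> [_ fR] cx fx; have [c c0 E] := fR _ cx fx.
have -> : peval f x = c^-1 *: phi x by rewrite E scalerA mulVf // scale1r.
by apply: coneZ; rewrite ?invr_eq0 //; apply: phiR.1.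
Qed.

Lemma represents_tangent d f x u : represents phi d f -> cone x -> dF x u = 0 ->
  dF (peval f x) (diffl f x u) = 0.
Proof.
move=> fR cx Du; have [q [qE <-]] := dird_comp F f.
apply: (tangential_derivative smF char2 _ cx Du) => v cv; rewrite qE.
have [->|fv] := eqVneq (peval f v) 0; first exact: F0 smF.
by case: (represents_cone fR cv fv).
Qed.

Lemma represents_colinear d f d' f' x : represents phi d f -> represents phi d' f' ->
  cone x -> colinear (peval f x) (peval f' x).
Proof.
move=> [_ fR] [_ fR'] cx.
have [->|f'x] := eqVneq (peval f' x) 0; first exact: colinear0.
have [->|fx] := eqVneq (peval f x) 0; first exact/colinear_sym/colinear0.
have [c c0 E] := fR _ cx fx; have [c' c'0 E'] := fR' _ cx f'x.
have -> : peval f' x = (c'^-1 * c) *: peval f x.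
  by rewrite -scalerA -E E' scalerA mulVf // scale1r.
exact: colinearZ.
Qed.

(** In positive degree the representing map vanishes at the origin, and is then
colinear to any other map there. *)
Lemma regular_lift_pos chi x : regular_lift chi -> cone x -> exists d f,
  represents chi d.+1 f /\ peval f x != 0.
Proof.
move=> chiR cx; have [x0 _] := cx; have [d [f [[hf fR] fx]]] := chiR.2 x cx.
have [i xi] := row_nz x0.
have fXE y : peval (fun j => 'X_i * f j) y = y 0 i *: peval f y.
  by apply/rowP => j; rewrite !mxE mevalM mevalXU.
exists d, (fun j => 'X_i * f j); split; last by rewrite fXE scaler_eq0 negb_or xi.
split=> [j|y cy].
  by rewrite -[d.+1]add1n; apply: dhomogM (hf j); rewrite dhomogX /= mdeg1.
rewrite fXE scaler_eq0 negb_or => /andP[yi fy]; have [c c0 E] := fR y cy fy.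
exists (c / y 0 i); first by rewrite mulf_neq0 ?invr_eq0.
by rewrite scalerA divfK.
Qed.

(** The differential of the inverse automorphism is a left inverse, up to a factor
and modulo the direction of the point. *)
Lemma represents_immersion d f x u v w w' : represents phi d f -> cone x ->
  peval f x != 0 -> dF x u = 0 -> dF x v = 0 -> det4 x u v w' != 0 ->
  dF (peval f x) w != 0 ->
  det4 (peval f x) (diffl f x u) (diffl f x v) w != 0.
Proof.
move=> fR cx fx Du Dv xuv Dw; have cfx := represents_cone fR cx fx.
have [d' [e [eR efx]]] := regular_lift_pos psiR cfx.
have /fin_all_exists[h hE] i := dird_comp (e i) f.
have hfE y : peval h y = peval e (peval f y).
  by apply/rowP => i; rewrite !mxE (hE i).1.
have dhE u1 : diffl h x u1 = diffl e (peval f x) (diffl f x u1).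
  by apply/rowP => i; rewrite !mxE (hE i).2.
have idE y : peval (fun i => 'X_i) y = y by apply/rowP => i; rewrite mxE mevalXU.
have didE y z : diffl (fun i => 'X_i) y z = z by apply/rowP => i; rewrite mxE dirdX.
have eh y : cone y -> colinear (peval (fun i => 'X_i) y) (peval h y).
  move=> cy; rewrite idE hfE.
  have [->|ey] := eqVneq (peval e (peval f y)) 0; first exact: colinear0.
  have fy : peval f y != 0.
    apply: contraNneq ey => ->.
    by have := peval_scale 0 0 eR.1; rewrite scale0r expr0n /= scale0r => ->.
  have [c c0 phiE] := fR.2 y cy fy.
  have [c1 c10 psiE] := phiK cy.
  have ephi : peval e (phi y) = c ^+ d'.+1 *: peval e (peval f y).
    by rewrite phiE (peval_scale _ _ eR.1).
  have [|c2 c20 psiE2] := eR.2 _ (phiR.1 y cy).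
    by rewrite ephi scaler_eq0 negb_or ey andbT expf_neq0.
  have -> : peval e (peval f y) = (c1 / (c2 * c ^+ d'.+1)) *: y.
    rewrite mulrC -scalerA -psiE psiE2 ephi !scalerA mulVf ?scale1r //.
    by rewrite mulf_neq0 ?expf_neq0.
  exact: colinearZ.
have x0 := cx.1.
have := eh x cx; rewrite idE => /(colinearP x0)[l lE].
have l0 : l != 0.
  by apply: contraNneq efx => l0; rewrite -hfE lE l0 scale0r.
have back u1 : dF x u1 = 0 -> exists b,
    diffl e (peval f x) (diffl f x u1) = l *: u1 + b *: x.
  move=> Du1; have := @colinear_diffl (fun i => 'X_i) h x u1 l eh cx Du1.
  by rewrite idE didE -dhE => /(_ x0 lE).
have [bu Eu] := back u Du; have [bv Ev] := back v Dv.
have lin := dF_linear F (peval f x).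
apply: det4_free => k E.
have k3 : k 0 3 = 0.
  have := congr1 (dF (peval f x)) E; rewrite !(linDD lin) !(linZ lin) (lin0 lin).
  rewrite (dF_euler smF cfx.2) (represents_tangent fR cx Du).
  rewrite (represents_tangent fR cx Dv) !mulr0 !add0r => /eqP.
  by rewrite mulf_eq0 (negbTE Dw) orbF => /eqP.
have := congr1 (diffl e (peval f x)) E; rewrite k3 scale0r addr0.
rewrite !difflD !difflZ diffl0 Eu Ev (diffl_euler _ eR.1) -hfE lE => E2.
have [|_ /eqP k1 /eqP k2 _] := @det4_indep _ x u v w'
    (k 0 0 * d'.+1%:R * l + k 0 1 * bu + k 0 2 * bv) (k 0 1 * l) (k 0 2 * l) 0 xuv.
  by rewrite -[RHS]E2; apply/rowP => j; rewrite !mxE; ring.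
move: k1 k2; rewrite !mulf_eq0 (negbTE l0) !orbF => /eqP k1 /eqP k2.
move: E; rewrite k1 k2 k3 !scale0r !addr0 => /eqP.
rewrite scaler_eq0 (negbTE fx) orbF => /eqP k0.
apply/rowP => j; rewrite mxE; have [n ->] : exists n : 'I_4, j = n by exists j.
by case: n => [[|[|[|[|//]]]] ?]; [rewrite -[RHS]k0|rewrite -[RHS]k1|rewrite -[RHS]k2|rewrite -[RHS]k3];
  congr (k _ _); apply/val_inj.
Qed.

(** The lift [z] of [phi x] for which the pull-back of the invariant two-form is
the two-form itself; with [f], [det4 f (df u) (df v) w / dF f w] is the
pulled-back form, and [det4 x u v w' / dF x w'] the form at [x]. *)
Definition jacobian_lift x z : Prop :=
  forall d f, represents phi d f -> peval f x != 0 ->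
  forall u v w w', dF x u = 0 -> dF x v = 0 ->
    (det4 (peval f x) (diffl f x u) (diffl f x v) w * dF x w') *: z =
    (det4 x u v w' * dF (peval f x) w) *: peval f x.

Lemma frame_at d f x : represents phi d f -> cone x -> peval f x != 0 ->
  exists u v w w', [/\ dF x u = 0 /\ dF x v = 0, dF x w' != 0,
    dF (peval f x) w != 0, det4 x u v w' != 0 &
    det4 (peval f x) (diffl f x u) (diffl f x v) w != 0].
Proof.
move=> fR cx fx; have [x0 Fx] := cx; have [w' Dw'] := smooth_dF smF cx.
have [w Dw] := smooth_dF smF (represents_cone fR cx fx).
have [u [v [Du Dv uv]]] := tangent_frame (dF_linear F x) x0 (dF_euler smF Fx) Dw'.
exists u, v, w, w'; split=> //.
exact: (represents_immersion fR cx fx Du Dv uv Dw).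
Qed.

Lemma jacobian_lift_uniq x y z : cone x ->
  jacobian_lift x y -> jacobian_lift x z -> y = z.
Proof.
move=> cx yx zx; have [d [f [fR fx]]] := phiR.2 x cx.
have [u [v [w [w' [[Du Dv] Dw' _ _ fuv]]]]] := frame_at fR cx fx.
apply: (scalerI (mulf_neq0 fuv Dw')).
by rewrite (yx _ _ fR fx _ _ _ _ Du Dv) (zx _ _ fR fx _ _ _ _ Du Dv).
Qed.

(** For other data [f], [u], [v], the matrix expressing [u] and [v] in the chosen
frame modulo [x] contributes its determinant to both sides; and a factor [k] of
[f] enters both with exponent three, as the two-form has weight one. *)
Lemma jacobian_lift_exists x : cone x ->
  exists2 z, jacobian_lift x z & exists2 c, c != 0 & z = c *: phi x.
Proof.
move=> cx; have [d0 [f0 [f0R f0x]]] := phiR.2 x cx.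
have [u0 [v0 [w0 [w0' [[Du0 Dv0] Dw0' Dw0 uv0 fuv0]]]]] := frame_at f0R cx f0x.
pose N w := det4 (peval f0 x) (diffl f0 x u0) (diffl f0 x v0) w.
pose M w := det4 x u0 v0 w.
pose rho := (M w0' * dF (peval f0 x) w0) / (N w0 * dF x w0').
have cf0 := represents_cone f0R cx f0x.
have rho0 : rho != 0 by rewrite !mulf_neq0 // invr_eq0 !mulf_neq0.
have [c c0 phiE] := f0R.2 x cx f0x.
exists (rho *: peval f0 x); last first.
  exists (rho / c); first by rewrite mulf_neq0 ?invr_eq0.
  by rewrite phiE scalerA divfK.
move=> d f fR fx u v w w' Du Dv.
have [k k0 fE] : exists2 k, k != 0 & peval f x = k *: peval f0 x.
  have [k kE] := colinearP f0x (represents_colinear f0R fR cx).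
  by exists k => //; apply: contraNneq fx => k0; rewrite kE k0 scale0r.
have dfE u1 : dF x u1 = 0 -> exists b,
    diffl f x u1 = k *: diffl f0 x u1 + b *: peval f0 x.
  move=> Du1; apply: colinear_diffl => // y cy; exact: represents_colinear f0R fR cy.
have span u1 : dF x u1 = 0 -> exists e0 e1 e2 : K, u1 = e0 *: x + e1 *: u0 + e2 *: v0.
  move=> Du1; have [e E] := det4_span u1 uv0.
  have lin := dF_linear F x.
  move: (Du1); rewrite {1}E !(linDD lin) !(linZ lin) Du0 Dv0 (dF_euler smF cx.2).
  rewrite !mulr0 !add0r => /eqP; rewrite mulf_eq0 (negbTE Dw0') orbF => /eqP e3.
  by exists (e 0 0), (e 0 1), (e 0 2); rewrite {1}E e3 scale0r addr0.
have [bu bE] := dfE u Du; have [bv bE'] := dfE v Dv.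
have [e0 [e1 [e2 uE]]] := span u Du; have [g0 [g1 [g2 vE]]] := span v Dv.
have ME : det4 x u v w' = (e1 * g2 - e2 * g1) * M w'.
  by rewrite uE vE det4_change.
have NE : det4 (peval f x) (diffl f x u) (diffl f x v) w =
    k ^+ 3 * ((e1 * g2 - e2 * g1) * N w).
  have lift1 a0 a1 a2 : diffl f0 x (a0 *: x + a1 *: u0 + a2 *: v0) =
      (a0 * d0%:R) *: peval f0 x + a1 *: diffl f0 x u0 + a2 *: diffl f0 x v0.
    by rewrite !difflD !difflZ (diffl_euler _ f0R.1) scalerA.
  rewrite bE bE' fE uE vE !lift1 /N.
  set P := peval f0 x; set U := diffl f0 x u0; set V := diffl f0 x v0.
  rewrite -(det4_change P U V w (e0 * d0%:R + bu / k) e1 e2 (g0 * d0%:R + bv / k) g1 g2).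
  transitivity (det4 (k *: P) (k *: ((e0 * d0%:R + bu / k) *: P + e1 *: U + e2 *: V))
    (k *: ((g0 * d0%:R + bv / k) *: P + g1 *: U + g2 *: V)) w).
    by congr det4; apply/rowP => j; rewrite !mxE; field.
  by rewrite det4_scale; ring.
have Mp := det4_proportional (dF_linear F x) w' (dF_euler smF cx.2) Du0 Dv0 Dw0'.
have Np := det4_proportional (dF_linear F (peval f0 x)) w (dF_euler smF cf0.2)
  (represents_tangent f0R cx Du0) (represents_tangent f0R cx Dv0) Dw0.
rewrite ME NE fE (dF_scale smF) // !scalerA; congr (_ *: _).
rewrite -/(M w') -/(M w0') in Mp; rewrite -/(N w) -/(N w0) in Np.
have -> : dF (peval f0 x) w = N w * dF (peval f0 x) w0 / N w0.
  by rewrite Np mulrC mulKf.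
have -> : dF x w' = M w' * dF x w0' / M w0' by rewrite Mp mulrC mulKf.
by rewrite /rho; field; rewrite fuv0 Dw0' uv0.
Qed.

(** The Jacobian lift is defined pointwise without choice of coordinates; around
a given point, a fixed representing map and tangent vector fields exhibit it as a
quotient of polynomials. *)
Theorem weight1_lift : exists g, regular_weight1 F g /\
  forall x, cone x -> exists2 c, c != 0 & g x = c *: phi x.
Proof.
have /choice[g gE] x : exists z, cone x ->
    jacobian_lift x z /\ exists2 c, c != 0 & z = c *: phi x.
  have [cx|ncx] := pselect (cone x); last by exists 0.
  by have [z zx zc] := jacobian_lift_exists cx; exists z.
exists g; split; last by move=> x /gE[].
split=> [x0 cx0|c x c0 cx].
  have [d [f [fR fx]]] := phiR.2 x0 cx0.
  have [u [v [w [w' [[Du Dv] Dw' Dw uv fuv]]]]] := frame_at fR cx0 fx.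
  (* Tangent vector fields on the cone that extend [u] and [v] up to a factor. *)
  pose fld (e : 'rV[K]_4) y := dF y w' *: e - dF y e *: w'.
  have Dfld (e : 'rV[K]_4) y : dF y (fld e y) = 0.
    rewrite /fld -scaleNr (linDD (dF_linear F y)) !(linZ (dF_linear F y)); ring.
  have fld0 (e : 'rV[K]_4) : dF x0 e = 0 -> fld e x0 = dF x0 w' *: e.
    by move=> De; rewrite /fld De scale0r subr0.
  have PdF (e : 'rV[K]_4) : polyfun (fun y => dF y e).
    by apply: (@polyfun_dird _ _ _ F id (fun=> e)); [apply: polymap_id|apply: polymap_cst].
  have Pfld (e : 'rV[K]_4) : polymap (fld e).
    by apply: polymapD; [|apply: polymapN]; apply: polymapZ => //; apply: polymap_cst.
  have Pf := polymap_peval f.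
  have PDf (e : 'rV[K]_4) : polymap (fun y => diffl f y (fld e y)).
    by apply: polymap_diffl => //; apply: polymap_id.
  exists (fun y => (det4 y (fld u y) (fld v y) w' * dF (peval f y) w) *: peval f y).
  exists (fun y => det4 (peval f y) (diffl f y (fld u y)) (diffl f y (fld v y)) w
                   * dF y w').
  split.
  - apply: polymapZ => //; apply: polyfunM; last exact: polyfun_comp (PdF w) Pf.
    by apply: polyfun_det4 => //; [apply: polymap_id|apply: polymap_cst].
  - by apply: polyfunM => //; apply: polyfun_det4 => //; apply: polymap_cst.
  - rewrite mulf_neq0 // !fld0 // !difflZ -[peval f x0]scale1r det4_scale.
    by rewrite !mul1r !mulf_neq0 ?oner_eq0.
  - move=> y cy; have [fy0|fy] := eqVneq (peval f y) 0; last exact: (gE y cy).1 fR fy _ _ _ _ _ _.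
    by rewrite fy0 scaler0 det4E !mxE !mul0r !subr0 !addr0 !mul0r scale0r.
have ccx := coneZ smF c0 cx.
apply: (jacobian_lift_uniq ccx (gE _ ccx).1) => d f fR fcx u v w w' Du Dv.
have fE := peval_scale c x fR.1.
have cd0 : c ^+ d != 0 by rewrite expf_neq0.
have fx : peval f x != 0 by move: fcx; rewrite fE scaler_eq0 negb_or => /andP[].
have tan u1 : dF (c *: x) u1 = 0 -> dF x u1 = 0.
  rewrite (dF_scale smF) // => /eqP; rewrite mulf_eq0 expf_eq0 (negbTE c0) /=.
  by move/eqP.
have dfE u1 : diffl f (c *: x) u1 = (c ^+ d / c) *: diffl f x u1.
  apply/rowP => i; rewrite !mxE; apply: (mulfI c0).
  by rewrite (dird_scale _ _ _ (fR.1 i)); field.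
have := (gE x cx).1 d f fR fx u v w w' (tan u Du) (tan v Dv).
rewrite !dfE fE !(dF_scale smF) // det4_scale det4_scale1 => E.
transitivity ((c ^+ d * c ^+ d * c ^+ d * c) *:
   ((det4 (peval f x) (diffl f x u) (diffl f x v) w * dF x w') *: g x)).
  by rewrite !scalerA; congr (_ *: _); field.
by rewrite E !scalerA; congr (_ *: _); ring.
Qed.

End Lift.
End Jacobian.

(** * Points of the surface and vectors of the cone *)

Section SurfacePoints.
Variables (K : closedFieldType) (F : {mpoly K[4]}).
Hypothesis (smF : smooth_cubic F).
Implicit Types (u v w : 'rV[K]_4) (x y : surface F) (c : K).

Lemma coords_cone x : cone F (coords x).
Proof.
have /andP[/eqP dx /eqP Fx] := valP x; split=> //.
rewrite vpick0; apply/eqP => x0; have : \dim (line x) = 1%N by [].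
by rewrite x0 dimv0.
Qed.

Lemma line_coords x : line x = <[coords x]>%VS.
Proof.
have /andP[/eqP dx _] := valP x; apply/esym/eqP; rewrite eqEdim.
rewrite -memvE memv_pick dim_vline (coords_cone x).1 /=.
by rewrite -/(line x) in dx; rewrite dx.
Qed.

Lemma vlineZ c v : c != 0 -> <[c *: v]>%VS = <[v]>%VS :> {vspace 'rV[K]_4}.
Proof.
move=> c0; apply/eqP; rewrite eqEsubv -!memvE memvZ ?memv_line //=.
by rewrite -{1}[v]scale1r -(mulVf c0) -scalerA memvZ ?memv_line.
Qed.

Lemma vline_eqP u v : u != 0 -> <[u]>%VS = <[v]>%VS :> {vspace 'rV[K]_4} ->
  exists2 c, c != 0 & u = c *: v.
Proof.
move=> u0 uv; have := memv_line u; rewrite uv => /vlineP[c uE].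
by exists c => //; apply: contraNneq u0 => c0; rewrite uE c0 scale0r.
Qed.

Lemma surface_point v : cone F v -> exists x, line x = <[v]>%VS.
Proof.
case=> v0 Fv; have P : (\dim <[v]>%VS == 1%N) && (F.@[vpick <[v]>%VS 0] == 0).
  rewrite dim_vline v0 eqxx /=; have /vlineP[c ->] := memv_pick <[v]>%VS.
  by rewrite (F_scale smF) Fv mulr0.
by exists (exist (fun L : {vspace 'rV[K]_4} => (\dim L == 1%N) && (F.@[vpick L 0] == 0)) _ P).
Qed.


Definition lifts (rho : surface F -> surface F) (phi : 'rV[K]_4 -> 'rV[K]_4) : Prop :=
  forall v x, line x = <[v]>%VS -> phi v = coords (rho x).

Lemma lifts_exist rho : exists phi, lifts rho phi.
Proof.
have /choice[phi phiE] v : exists z, forall x, line x = <[v]>%VS -> z = coords (rho x).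
  have [[x xv]|nx] := pselect (exists x, line x = <[v]>%VS).
    exists (coords (rho x)) => y yv; congr (coords (rho _)).
    by apply: val_inj; rewrite -!/(line _) xv yv.
  by exists 0 => x xv; case: nx; exists x.
by exists phi.
Qed.

Lemma lifts_cone rho phi v : lifts rho phi -> cone F v -> cone F (phi v).
Proof.
by move=> L /surface_point[x xv]; rewrite (L _ _ xv); apply: coords_cone.
Qed.

Lemma lifts_scale rho phi c v : lifts rho phi -> c != 0 -> cone F v ->
  phi (c *: v) = phi v.
Proof.
move=> L c0 /surface_point[x xv]; rewrite (L _ _ xv) (L _ x) //.
by rewrite xv vlineZ.
Qed.

Lemma lifts_line rho phi v x : lifts rho phi -> line x = <[v]>%VS ->
  line (rho x) = <[phi v]>%VS.
Proof. by move=> L xv; rewrite (L _ _ xv) -line_coords. Qed.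

Lemma lifts_regular rho phi : lifts rho phi -> regular_map rho -> regular_lift F phi.
Proof.
move=> L reg; split=> [v|v cv]; first exact: (lifts_cone L).
have [x xv] := surface_point cv; have [d [f [hf fx fE]]] := reg x.
have [c c0 vE] : exists2 c, c != 0 & coords x = c *: v.
  by apply: vline_eqP; [exact: (coords_cone x).1|rewrite -line_coords].
exists d, f; split; last first.
  by move: fx; rewrite vE (peval_scale _ _ hf) scaler_eq0 negb_or => /andP[].
split=> // u cu fu; have [y yu] := surface_point cu.
have [b b0 yE] : exists2 b, b != 0 & coords y = b *: u.
  by apply: vline_eqP; [exact: (coords_cone y).1|rewrite -line_coords].
have fyE : peval f (coords y) = b ^+ d *: peval f u by rewrite yE (peval_scale _ _ hf).
have [|e e0 E] := @vline_eqP (coords (rho y)) (peval f (coords y)) (coords_cone _).1.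
  rewrite -line_coords fE // fyE scaler_eq0 negb_or fu andbT expf_neq0 //.
exists (e * b ^+ d); first by rewrite mulf_neq0 ?expf_neq0.
by rewrite (L _ _ yu) E fyE scalerA.
Qed.

End SurfacePoints.

(** * The residual intersection point of a chord *)

Section ResidualPoint.
Variables (K : closedFieldType) (F : {mpoly K[4]}).
Hypotheses (smF : smooth_cubic F) (char2 : 2%:R != 0 :> K).
Implicit Types (p q x : 'rV[K]_4) (a b : K).
Local Notation dF := (dird F).
Local Notation cone := (cone F).

(** By [F_chord], the zeros of [F] on the line through [p] and [q] are [p], [q]
and this point. *)
Definition residual p q := dF q p *: p - dF p q *: q.

Lemma residualC p q : residual q p = - residual p q.
Proof. by rewrite /residual opprB. Qed.

Lemma residualZ a b p q :
  residual (a *: p) (b *: q) = (a ^+ 2 * b ^+ 2) *: residual p q.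
Proof.
rewrite /residual !(dF_scale smF) !(dFZ F) scalerBr !scalerA.
by congr (_ *: _ - _ *: _); ring.
Qed.

Lemma F_residual p q : F.@[p 0] = 0 -> F.@[q 0] = 0 -> F.@[(residual p q) 0] = 0.
Proof. by move=> Fp Fq; rewrite /residual -scaleNr (F_chord smF) //; ring. Qed.

Lemma residual_cone p q : cone p -> cone q -> dF p q != 0 -> dF q p != 0 ->
  cone (residual p q).
Proof.
move=> [p0 Fp] [q0 Fq] A0 B0; split; last exact: F_residual.
apply: contraNneq A0 => /eqP; rewrite subr_eq0 => /eqP E.
have qE : p = (dF p q / dF q p) *: q.
  by apply: (scalerI B0); rewrite E scalerA mulrCA divff ?mulr1.
by rewrite {1}qE (dF_scale smF) (dF_euler smF Fq) mulr0.
Qed.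

(** On a transversal line through [x], the other two points have [x] as residual
point. *)
Lemma residual_surj x : cone x -> exists p q,
  [/\ cone p, cone q, dF p q != 0, dF q p != 0 &
    exists2 c, c != 0 & residual p q = c *: x].
Proof.
move=> cx; have [x0 Fx] := cx.
have [w [t1 [t2 [Fw _ /and3P[t10 t20 t12] tE]]]] := three_points smF char2 cx.
have ct t : t = t1 \/ t = t2 -> cone (x + t *: w).
  move=> tt; split; last by rewrite tE; case: tt => ->; rewrite subrr !(mulr0, mul0r).
  apply: contraNneq Fw => /eqP; rewrite addr_eq0 => /eqP xw.
  have t0 : t != 0 by case: tt => ->.
  have := Fx; rewrite xw -scaleNr (F_scale smF) => /eqP.
  by rewrite mulf_eq0 expf_eq0 oppr_eq0 /= (negbTE t0).
have cp := ct t1 (or_introl erefl); have cq := ct t2 (or_intror erefl).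
set p := x + t1 *: w in cp *; set q := x + t2 *: w in cq *.
have xE : (t2 - t1) *: x = t2 *: p + (- t1) *: q.
  by apply/rowP => j; rewrite ?/p ?/q !mxE; ring.
have E1 : t2 * dF p q = t1 * dF q p.
  have := F_chord smF t2 (- t1) cp.2 cq.2.
  rewrite -xE (F_scale smF) Fx mulr0 => /esym/eqP.
  rewrite !mulf_eq0 oppr_eq0 (negbTE t10) (negbTE t20) /= mulNr subr_eq0.
  by move/eqP.
have E2 : dF p q != dF q p.
  have := F_chord smF 1 (-1) cp.2 cq.2.
  have -> : 1 *: p + (-1) *: q = (t1 - t2) *: w.
    by apply/rowP => j; rewrite ?/p ?/q !mxE; ring.
  rewrite (F_scale smF) => E.
  have : (t1 - t2) ^+ 3 * F.@[w 0] != 0 by rewrite mulf_neq0 // expf_neq0 // subr_eq0.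
  by rewrite E; apply: contraNneq => ->; apply/eqP; ring.
have B0 : dF q p != 0.
  apply: contraNneq E2 => B0; move: E1; rewrite B0 mulr0 => /eqP.
  by rewrite mulf_eq0 (negbTE t20).
have A0 : dF p q != 0.
  by apply: contraNneq B0 => A0; move/esym/eqP: E1;
    rewrite A0 mulr0 mulf_eq0 (negbTE t10).
exists p, q; split=> //; exists (dF q p * (t2 - t1) / t2).
  by rewrite !mulf_neq0 ?invr_eq0 // subr_eq0 eq_sym.
apply: (scalerI t20); rewrite scalerBr !scalerA E1.
have -> : t2 * (dF q p * (t2 - t1) / t2) = dF q p * (t2 - t1) by field.
by rewrite -(scalerA (dF q p) (t2 - t1)) xE; apply/rowP => j; rewrite !mxE; ring.
Qed.

Lemma polyfun_dF n (p q : 'rV[K]_n -> 'rV[K]_4) : polymap p -> polymap q ->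
  polyfun (fun v => dF (p v) (q v)).
Proof. exact: polyfun_dird. Qed.

Lemma polymap_residual n (p q : 'rV[K]_n -> 'rV[K]_4) : polymap p -> polymap q ->
  polymap (fun v => residual (p v) (q v)).
Proof.
move=> Pp Pq; apply: polymapD; first by apply: (polymapZ _ Pp); apply: polyfun_dF.
by apply: polymapN; apply: (polymapZ _ Pq); apply: polyfun_dF.
Qed.

(** The Jacobian lift is linear on the collinear triple [p], [q], [residual p q];
as [F] vanishes at the image of the third point, [F_chord] identifies it as the
residual point of the other two images. *)
Lemma residual_natural phi psi p q a b :
  regular_lift F phi -> regular_lift F psi ->
  (forall x, cone x -> exists2 c, c != 0 & psi (phi x) = c *: x) ->
  cone p -> cone q -> dF p q != 0 -> dF q p != 0 ->
  exists c, residual (a *: phi p) (b *: phi q) = c *: phi (residual p q).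
Proof.
move=> phiR psiR phiK cp cq A0 B0.
have [g [wg gphi]] := weight1_lift smF char2 phiR psiR phiK.
have gE := weight1_chord smF wg cp cq A0 B0.
have cg y : cone y -> cone (g y).
  by move=> cy; have [c c0 ->] := gphi y cy; apply: coneZ => //; apply: phiR.1.
have cr := residual_cone cp cq A0 B0.
have inv y : cone y -> exists c, phi y = c *: g y.
  move=> cy; have [c c0 ->] := gphi y cy; exists c^-1.
  by rewrite scalerA mulVf // scale1r.
have [cr' c0 grE] := gphi _ cr.
have [kp pE] := inv p cp; have [kq qE] := inv q cq.
have E : dF q p * dF (g p) (g q) = dF p q * dF (g q) (g p).
  have := F_chord smF (dF q p) (- dF p q) (cg p cp).2 (cg q cq).2.
  rewrite scaleNr -gE (cg _ cr).2 => /esym/eqP.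
  rewrite !mulf_eq0 oppr_eq0 (negbTE A0) (negbTE B0) /= mulNr subr_eq0.
  by move/eqP.
have resE : residual (g p) (g q) = (dF (g q) (g p) / dF q p) *: g (residual p q).
  rewrite gE scalerBr !scalerA divfK //; congr (_ - _ *: _).
  by apply: (mulfI B0); rewrite E; field.
by rewrite pE qE !scalerA residualZ resE grE !scalerA; eexists.
Qed.

End ResidualPoint.

(** * Dominance of products *)

Section Dominance.
Variables (K : closedFieldType) (F : {mpoly K[4]}).
Hypothesis (smF : smooth_cubic F).
Implicit Types (p q x y : 'rV[K]_4) (c : K).
Local Notation cone := (cone F).

Lemma dominant_fun n (f : 'I_4 -> {mpoly K[n]}) d (h : 'rV[K]_4 -> K) :
  dominant F f -> polyfun h -> (forall c x, h (c *: x) = c ^+ d * h x) ->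
  (forall v, peval f v != 0 -> h (peval f v) = 0) -> forall x, cone x -> h x = 0.
Proof.
move=> dom hP hc hf x cx; have [P homP hE] := dhomog_fun hP hc.
have [y yx] := surface_point smF cx.
have [c c0 xE] : exists2 c, c != 0 & x = c *: coords y.
  by apply: vline_eqP; [exact: cx.1|rewrite -line_coords].
by rewrite xE hc hE (dom d P homP) ?mulr0 // => v fv; rewrite -hE hf.
Qed.

Variables (n : nat) (f : 'I_4 -> {mpoly K[n]}) (dom : dominant F f).
Variables (phi : 'rV[K]_4 -> 'rV[K]_4) (d : nat) (e : 'I_4 -> {mpoly K[4]}).
Hypotheses (ratF : forall v, F.@[(peval f v) 0] = 0) (phiR : regular_lift F phi).
Hypothesis phi_surj : forall y, cone y ->
  exists2 x, cone x & exists2 c, c != 0 & phi x = c *: y.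
Hypotheses (eR : represents F phi d.+1 e) (e_nz : exists2 x, cone x & peval e x != 0).

Lemma form_peval0 : peval e 0 = 0.
Proof. by have := peval_scale 0 0 eR.1; rewrite scale0r expr0n /= scale0r. Qed.

Lemma dominant_rep_nz : exists v i, peval e (peval f v) 0 i != 0.
Proof.
apply: contrapT => none; have [x cx /row_nz[i /eqP]] := e_nz; apply.
apply: (@dominant_fun _ f d.+1 (fun x => peval e x 0 i)) => //.
- exact: polymap_peval.
- by move=> c y; rewrite (peval_scale _ _ eR.1) mxE.
move=> v _; apply/eqP/negPn/negP => ev; apply: none.
by exists v, i.
Qed.

(** One argument at a time. As [e] may vanish at points of interest, the second
step uses a representing map [e'] around the given point, which is proportional
to [e] on a dense subset of the image of [f]. *)
Lemma dominant_pair (Th : 'rV[K]_4 -> 'rV[K]_4 -> K) k l :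
  (forall q, polyfun (fun p => Th p q)) -> (forall p, polyfun (Th p)) ->
  (forall c p q, Th (c *: p) q = c ^+ k * Th p q) ->
  (forall c p q, Th p (c *: q) = c ^+ l * Th p q) ->
  (forall v1 v2, Th (peval f v1) (peval e (peval f v2)) = 0) ->
  forall p q, cone p -> cone q -> Th p q = 0.
Proof.
move=> P1 P2 h1 h2 Th0.
have Th1 p v : cone p -> Th p (peval e (peval f v)) = 0.
  by move=> cp; apply: (@dominant_fun _ f k (Th^~ (peval e (peval f v)))) cp.
move=> p q cp cq; have [y cy [c c0 yq]] := phi_surj cq.
have [d' [e' [e'R e'y]]] := regular_lift_pos phiR cy.
have Th2 v : Th p (peval e' (peval f v)) = 0.
  have [v0 [i ei]] := dominant_rep_nz; move: v.
  apply: (@polyfun_domain _ _ (fun v => peval e (peval f v) 0 i)).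
  - exact: (polymap_comp (polymap_peval e) (polymap_peval f)).
  - by apply: polyfun_comp (P2 p) _;
      apply: (polymap_comp (polymap_peval e') (polymap_peval f)).
  - move=> v; have [->|ev] := eqVneq (peval e (peval f v)) 0; first by rewrite mxE mul0r.
    have fv : peval f v != 0 by apply: contraNneq ev => ->; rewrite form_peval0.
    have cfv : cone (peval f v) by split.
    suff [b ->] : exists b, peval e' (peval f v) = b *: peval e (peval f v).
      by rewrite h2 Th1 // !mulr0.
    have [->|e'v] := eqVneq (peval e' (peval f v)) 0; first by exists 0; rewrite scale0r.
    have [b b0 bE] := eR.2 _ cfv ev; have [b' b'0 b'E] := e'R.2 _ cfv e'v.
    by exists (b'^-1 * b); rewrite -scalerA -bE b'E scalerA mulVf ?scale1r.
  - by exists v0.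
have [b b0 bE] := e'R.2 _ cy e'y.
have : Th p (peval e' y) = 0.
  apply: (@dominant_fun _ f (d'.+1 * l) (fun y => Th p (peval e' y))) cy => //.
    exact: polyfun_comp (P2 p) (polymap_peval e').
  by move=> c' y'; rewrite (peval_scale _ _ e'R.1) h2 exprM.
have -> : peval e' y = (b^-1 * c) *: q by rewrite -scalerA -yq bE scalerA mulVf ?scale1r.
by rewrite h2 => /eqP; rewrite mulf_eq0 expf_eq0 mulf_eq0 invr_eq0 (negbTE b0) (negbTE c0)
  andbF => /eqP.
Qed.

End Dominance.

(** * The representation induced from a subgroup of index two *)

Section InducedRepresentation.
Variables (K : fieldType) (gT : finGroupType) (G H : {group gT}) (n : nat).
Variable rH : mx_representation K H n.
Hypotheses (sHG : H \subset G) (idx : #|G : H|%g = 2).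
Local Open Scope group_scope.

Lemma index2_mem g h : g \in G -> h \in G -> (g * h \in H) = ((g \in H) == (h \in H)).
Proof.
move=> Gg Gh; have [Hg|nHg] := boolP (g \in H); first by rewrite groupMl // eq_sym eqb_id.
rewrite eq_sym eqbF_neg.
have := rcoset_index2 sHG idx (x := h^-1); rewrite !inE groupV.
have [Hh|nHh] := boolP (h \in H); first by rewrite groupMr // (negbTE nHg).
rewrite groupV Gh => /(_ isT)/setP/(_ g).
by rewrite mem_rcoset invgK !inE nHg Gg.
Qed.

Definition extend0 g : 'M[K]_n := if g \in H then rH g else 0%R.

(** Block [(t, t')] of the induced representation on row vectors, for [t], [t']
in the transversal [{1, s}], is the action of [t * g * t'^-1] if this is in [H]. *)
Definition induced_mx s g : 'M[K]_(n + n) :=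
  block_mx (extend0 g) (extend0 (g * s^-1)) (extend0 (s * g)) (extend0 (s * g * s^-1)).

Variable s : gT.
Hypotheses (Gs : s \in G) (nHs : s \notin H).

Lemma extend0_mul a b : a \in G -> b \in G ->
  (extend0 a *m extend0 b + extend0 (a * s^-1)%g *m extend0 (s * b)%g
   = extend0 (a * b)%g)%R.
Proof.
move=> Ga Gb; rewrite /extend0 !index2_mem ?groupV // (negbTE nHs).
have [Ha|nHa] := boolP (a \in H); have [Hb|nHb] := boolP (b \in H);
  rewrite /= ?mul0mx ?mulmx0 ?add0r ?addr0 //.
  by rewrite repr_mxM.
rewrite -repr_mxM ?mulgA ?mulgKV //.
  by rewrite index2_mem ?groupV // (negbTE nHs) (negbTE nHa).
by rewrite index2_mem // (negbTE nHs) (negbTE nHb).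
Qed.

Lemma induced_repr : mx_repr G (induced_mx s).
Proof.
split=> [|g h Gg Gh].
  rewrite /induced_mx mulg1 mul1g mulgV /extend0 group1 groupV (negbTE nHs).
  by rewrite repr_mx1 -scalar_mx_block.
have E := extend0_mul; rewrite /induced_mx mulmx_block.
have Gsg : s * g \in G by rewrite groupM.
have Ghs : h * s^-1 \in G by rewrite groupM ?groupV.
have := (E _ _ Gg Gh, E _ _ Gg Ghs, E _ _ Gsg Gh, E _ _ Gsg Ghs).
by rewrite !mulgA => -[[[-> ->] ->] ->].
Qed.

Lemma mul_induced w g : (w *m induced_mx s g)%R =
  row_mx (lsubmx w *m extend0 g + rsubmx w *m extend0 (s * g)%g)
    (lsubmx w *m extend0 (g * s^-1)%g + rsubmx w *m extend0 (s * g * s^-1)%g) :> 'rV_(n + n).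
Proof. by rewrite -{1}[w]hsubmxK mul_row_block. Qed.

Lemma mul_induced_in (w : 'rV_(n + n)) g : g \in H ->
  (w *m induced_mx s g)%R =
  row_mx (lsubmx w *m rH g) (rsubmx w *m rH (s * g * s^-1)%g).
Proof.
move=> Hg; have Gg := subsetP sHG g Hg.
rewrite mul_induced /extend0 !index2_mem ?groupM ?groupV // Hg (negbTE nHs) /=.
by rewrite !mulmx0 addr0 add0r.
Qed.

Lemma mul_induced_out (w : 'rV_(n + n)) g : g \in G -> g \notin H ->
  (w *m induced_mx s g)%R =
  row_mx (rsubmx w *m rH (s * g)%g) (lsubmx w *m rH (g * s^-1)%g).
Proof.
move=> Gg nHg.
rewrite mul_induced /extend0 !index2_mem ?groupM ?groupV // (negbTE nHg) (negbTE nHs) /=.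
by rewrite !mulmx0 addr0 add0r.
Qed.

End InducedRepresentation.

(** * The third point on the chord *)

Section Main.
Variables (K : closedFieldType) (F : {mpoly K[4]}).
Hypotheses (smF : smooth_cubic F) (char2 : 2%:R != 0 :> K).
Variables (gT : finGroupType) (G H : {group gT}) (to : action G (surface F)).
Hypotheses (toR : regular_action to) (toF : faithful_action to).
Hypotheses (sHG : H \subset G) (idx : #|G : H|%g = 2).
Local Notation dF := (dird F).
Local Notation cone := (cone F).
Local Notation residual := (residual F).

Lemma cone_exists : exists x, cone x.
Proof.
pose e1 : 'rV[K]_4 := delta_mx 0 0; pose e2 : 'rV[K]_4 := delta_mx 0 1.
have [F1|F1] := eqVneq F.@[e1 0] 0.
  exists e1; split=> //; apply/eqP => /rowP/(_ 0); rewrite !mxE /= => /eqP.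
  by rewrite oner_eq0.
have [Psi [mPsi szPsi PsiE]] := cubic_curve smF e2 0 F1.
have szp : size (map_poly (horner_eval (0 : K)) Psi) = 4%N.
  by rewrite size_map_poly_id0 // (eqP mPsi) rmorph1 oner_eq0.
have /closed_rootP[t] : size (map_poly (horner_eval (0 : K)) Psi) != 1%N by rewrite szp.
move/rootP; rewrite map_horner PsiE scale0r addr0 => /eqP.
rewrite mulf_eq0 invr_eq0 (negbTE F1) orbF => /eqP Ft.
exists (e2 + t *: e1); split=> //; apply/eqP => /rowP/(_ 1); rewrite !mxE /= => /eqP.
by rewrite mulr0 addr0 oner_eq0.
Qed.

Lemma toM g h x : g \in G -> h \in G -> to x (g * h)%g = to (to x g) h.
Proof.
move=> Gg Gh; have [_ actM] : is_action G to by case: (to).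
exact: actM.
Qed.

Lemma to1 x : to x 1%g = x.
Proof.
have [inj _] : is_action G to by case: (to).
by apply: (inj 1%g); rewrite -toM ?group1 // mulg1.
Qed.

Variable Phi : gT -> 'rV[K]_4 -> 'rV[K]_4.
Hypothesis PhiL : forall g, lifts (to^~ g) (Phi g).

Lemma Phi_cone g x : cone x -> cone (Phi g x).
Proof. exact: (lifts_cone smF (PhiL g)). Qed.

Lemma Phi_regular g : g \in G -> regular_lift F (Phi g).
Proof. by move=> Gg; apply: (lifts_regular smF (PhiL g)); apply: toR. Qed.

Lemma PhiM g h x : g \in G -> h \in G -> cone x -> Phi (g * h)%g x = Phi h (Phi g x).
Proof.
move=> Gg Gh cx; have [y yx] := surface_point smF cx.
by rewrite (PhiL _ yx) (PhiL _ (lifts_line (PhiL g) yx)) toM.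
Qed.

Lemma Phi1 x : cone x -> exists2 c, c != 0 & Phi 1%g x = c *: x.
Proof.
move=> cx; have [y yx] := surface_point smF cx.
apply: vline_eqP; first exact: (Phi_cone _ cx).1.
by rewrite -(lifts_line (PhiL _) yx) to1.
Qed.

Lemma PhiK g x : g \in G -> cone x -> exists2 c, c != 0 & Phi g^-1%g (Phi g x) = c *: x.
Proof. by move=> Gg cx; rewrite -PhiM ?groupV // mulgV; apply: Phi1. Qed.

Lemma PhiZ g c x : c != 0 -> cone x -> Phi g (c *: x) = Phi g x.
Proof. exact: (lifts_scale smF (PhiL g)). Qed.

Lemma Phi_surj g y : g \in G -> cone y ->
  exists2 x, cone x & exists2 c, c != 0 & Phi g x = c *: y.
Proof.
move=> Gg cy; exists (Phi g^-1%g y); first exact: Phi_cone.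
by have := @PhiK g^-1%g y; rewrite invgK groupV; apply.
Qed.

Variables (n : nat) (rH : mx_representation K H n) (f : 'I_4 -> {mpoly K[n]}).
Hypotheses (ratf : rational_map_to F f) (dom : dominant F f) (eqf : equivariant to rH f).
Variables (s : gT) (d : nat) (e : 'I_4 -> {mpoly K[4]}).
Hypotheses (Gs : s \in G) (nHs : s \notin H).
Hypotheses (eR : represents F (Phi s) d.+1 e) (e_nz : exists2 x, cone x & peval e x != 0).

(** The two points attached to a vector of the induced representation, one for
each coset of [H]. *)
Definition leg1 (w : 'rV[K]_(n + n)) := peval f (lsubmx w).
Definition leg2 (w : 'rV[K]_(n + n)) := peval e (peval f (rsubmx w)).
Definition third (w : 'rV[K]_(n + n)) := residual (leg1 w) (leg2 w).

Definition induced : mx_representation K G (n + n) :=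
  MxRepresentation (induced_repr rH sHG idx Gs nHs).

Lemma f_cone v : peval f v != 0 -> cone (peval f v).
Proof. by split=> //; apply: ratf.2. Qed.

Lemma f_equivariant h v : h \in H -> peval f v != 0 -> peval f (v *m rH h) != 0 ->
  exists2 c, c != 0 & peval f (v *m rH h) = c *: Phi h (peval f v).
Proof.
move=> Hh fv fvh; have [x xv] := surface_point smF (f_cone fv).
apply: vline_eqP => //.
by rewrite -(eqf Hh fv fvh xv) (lifts_line (PhiL h) xv).
Qed.

Lemma leg2_nz w : leg2 w != 0 -> peval f (rsubmx w) != 0.
Proof. by apply: contraNneq; rewrite /leg2 => ->; rewrite (form_peval0 eR). Qed.

Lemma leg2E w : leg2 w != 0 ->
  exists2 c, c != 0 & leg2 w = c *: Phi s (peval f (rsubmx w)).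
Proof.
move=> w2; have [c c0 E] := eR.2 _ (f_cone (leg2_nz w2)) w2.
by exists c^-1; rewrite ?invr_eq0 // E scalerA mulVf ?scale1r.
Qed.

Lemma leg2_cone w : leg2 w != 0 -> cone (leg2 w).
Proof.
move=> w2; have [c c0 ->] := leg2E w2.
by apply: coneZ => //; apply: Phi_cone; apply: f_cone; apply: leg2_nz.
Qed.

Lemma F_third w : F.@[(third w) 0] = 0.
Proof.
apply: F_residual => //; first exact: ratf.2.
by have [->|w2] := eqVneq (leg2 w) 0; [apply: F0 smF|case: (leg2_cone w2)].
Qed.

Lemma leg_dF_nz w : dF (leg1 w) (leg2 w) != 0 -> leg1 w != 0 /\ leg2 w != 0.
Proof.
move=> A0; split; apply: contraNneq A0 => ->; first by rewrite (dF0 smF).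
by rewrite (lin0 (dF_linear F _)).
Qed.

Lemma polymap_leg1 : polymap leg1.
Proof.
apply: polymap_comp (polymap_peval f) _ => i.
by apply: polyfun_ext (polyfun_coord _ (lshift n i)) => w; rewrite mxE.
Qed.

Lemma polymap_leg2 : polymap leg2.
Proof.
apply: polymap_comp (polymap_peval e) _; apply: polymap_comp (polymap_peval f) _ => i.
by apply: polyfun_ext (polyfun_coord _ (rshift n i)) => w; rewrite mxE.
Qed.

Lemma polymap_third : polymap third.
Proof. exact: polymap_residual polymap_leg1 polymap_leg2. Qed.

(** Elements of [H] preserve the two cosets, hence the order of the legs; the other
elements of [G] exchange them. *)
Lemma legs_permuted g w : g \in G -> leg1 w != 0 -> leg2 w != 0 ->
  leg1 (w *m induced g) != 0 -> leg2 (w *m induced g) != 0 ->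
  exists a b, let p := a *: Phi g (leg1 w) in let q := b *: Phi g (leg2 w) in
    (leg1 (w *m induced g) = p /\ leg2 (w *m induced g) = q) \/
    (leg1 (w *m induced g) = q /\ leg2 (w *m induced g) = p).
Proof.
move=> Gg w1 w2 wg1 wg2; have fr := leg2_nz w2; have fl : peval f (lsubmx w) != 0 by [].
have frg := leg2_nz wg2; have flg : peval f (lsubmx (w *m induced g)) != 0 by [].
have [c c0 cE] := leg2E w2; have [b b0 bE] := leg2E wg2.
have cfr := f_cone fr; have cfl := f_cone fl.
have [Hg|nHg] := boolP (g \in H).
  have wgE := mul_induced_in rH sHG idx Gs nHs w Hg : w *m induced g = _.
  have rE := congr1 rsubmx wgE; have lE := congr1 lsubmx wgE.
  rewrite row_mxKr in rE; rewrite row_mxKl in lE.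
  rewrite rE in frg bE; rewrite lE in flg.
  have Hsgs : (s * g * s^-1)%g \in H.
    by rewrite !(index2_mem sHG idx) ?groupM ?groupV // (negbTE nHs) Hg.
  have [a1 a10 a1E] := f_equivariant Hg fl flg.
  have [a2 a20 a2E] := f_equivariant Hsgs fr frg.
  exists a1, b; left; split; first by rewrite /leg1 lE a1E.
  rewrite bE a2E PhiZ //; last exact: Phi_cone.
  rewrite cE PhiZ //; last exact: Phi_cone.
  by rewrite -!PhiM ?groupM ?groupV // mulgKV.
have wgE := mul_induced_out rH sHG idx Gs nHs w Gg nHg : w *m induced g = _.
have rE := congr1 rsubmx wgE; have lE := congr1 lsubmx wgE.
rewrite row_mxKr in rE; rewrite row_mxKl in lE.
rewrite rE in frg bE; rewrite lE in flg.
have Hsg : (s * g)%g \in H by rewrite (index2_mem sHG idx) // (negbTE nHs) (negbTE nHg).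
have Hgs : (g * s^-1)%g \in H.
  by rewrite (index2_mem sHG idx) ?groupV // (negbTE nHs) (negbTE nHg).
have [a1 a10 a1E] := f_equivariant Hsg fr flg.
have [a2 a20 a2E] := f_equivariant Hgs fl frg.
exists b, a1; right; split.
  by rewrite /leg1 lE a1E cE PhiZ ?PhiM //; apply: Phi_cone.
rewrite bE a2E PhiZ //; last exact: Phi_cone.
by rewrite -!PhiM ?groupM ?groupV // mulgKV.
Qed.

Lemma pair_dominant (Th : 'rV[K]_4 -> 'rV[K]_4 -> K) k l :
  (forall q, polyfun (fun p => Th p q)) -> (forall p, polyfun (Th p)) ->
  (forall c p q, Th (c *: p) q = c ^+ k * Th p q) ->
  (forall c p q, Th p (c *: q) = c ^+ l * Th p q) ->
  (exists p q, [/\ cone p, cone q & Th p q != 0]) ->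
  exists w, Th (leg1 w) (leg2 w) != 0.
Proof.
move=> P1 P2 h1 h2 [p [q [cp cq /eqP nz]]]; apply: contrapT => none; apply: nz.
apply: (dominant_pair smF dom ratf.2 (Phi_regular Gs) _ eR e_nz P1 P2 h1 h2) => //.
  by move=> y cy; apply: Phi_surj.
move=> v1 v2; apply/eqP/negPn/negP => nz; apply: none.
by exists (row_mx v1 v2); rewrite /leg1 /leg2 row_mxKl row_mxKr.
Qed.

Lemma residual_pts : exists p q,
  [/\ cone p, cone q, dF p q != 0, dF q p != 0 & residual p q != 0].
Proof.
have [x cx] := cone_exists.
have [p [q [cp cq A0 B0 [c c0 E]]]] := residual_surj smF char2 cx.
by exists p, q; split=> //; rewrite E scaler_eq0 negb_or c0 cx.1.
Qed.

Lemma dF_legs_nz : exists w, dF (leg1 w) (leg2 w) * dF (leg2 w) (leg1 w) != 0.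
Proof.
have PI m : polymap (fun v : 'rV[K]_m => v) by apply: polymap_id.
have PC m (p : 'rV[K]_4) : polymap (fun _ : 'rV[K]_m => p) by apply: polymap_cst.
apply: (@pair_dominant (fun p q => dF p q * dF q p) 3 3).
- by move=> q; apply: polyfunM; apply: polyfun_dF.
- by move=> p; apply: polyfunM; apply: polyfun_dF.
- by move=> c p q; rewrite (dF_scale smF) (dFZ F); ring.
- by move=> c p q; rewrite (dF_scale smF) (dFZ F); ring.
have [p [q [cp cq A0 B0 _]]] := residual_pts.
by exists p, q; split=> //; apply: mulf_neq0.
Qed.

Lemma third_nz : exists w, third w != 0.
Proof.
have [p [q [cp cq _ _ /row_nz[i nz]]]] := residual_pts.
have [w wi] : exists w, third w 0 i != 0.
  apply: (@pair_dominant (fun p q => residual p q 0 i) 2 2).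
  - by move=> q'; apply: polymap_residual; [apply: polymap_id|apply: polymap_cst].
  - by move=> p'; apply: polymap_residual; [apply: polymap_cst|apply: polymap_id].
  - by move=> c p' q'; have := residualZ smF c 1 p' q'; rewrite scale1r expr1n mulr1 => ->; rewrite mxE.
  - by move=> c p' q'; have := residualZ smF 1 c p' q'; rewrite scale1r expr1n mul1r => ->; rewrite mxE.
  by exists p, q.
by exists w; apply: contraNneq wi => ->; rewrite mxE.
Qed.

(** Every point is residual to two others, by [residual_surj], and the pairs of
legs are dense. *)
Lemma third_dominant d' (P : {mpoly K[4]}) : P \is d'.-homog ->
  (forall w, third w != 0 -> P.@[(third w) 0] = 0) -> forall x, cone x -> P.@[x 0] = 0.
Proof.
move=> homP PV x cx; apply/eqP/negPn/negP => Px.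
have PP : polyfun (fun w => P.@[(third w) 0]).
  exact: polyfun_comp (polyfun_mpoly P) polymap_third.
have [w] : exists w, P.@[(third w) 0] != 0.
  apply: (@pair_dominant (fun p q => P.@[(residual p q) 0]) (2 * d') (2 * d')).
  - move=> q'; apply: polyfun_comp (polyfun_mpoly P) _.
    by apply: polymap_residual; [apply: polymap_id|apply: polymap_cst].
  - move=> p'; apply: polyfun_comp (polyfun_mpoly P) _.
    by apply: polymap_residual; [apply: polymap_cst|apply: polymap_id].
  - move=> c p' q'; have := residualZ smF c 1 p' q'.
    by rewrite scale1r expr1n mulr1 => ->; rewrite (dhomog_scale _ _ homP) exprM.
  - move=> c p' q'; have := residualZ smF 1 c p' q'.
    by rewrite scale1r expr1n mul1r => ->; rewrite (dhomog_scale _ _ homP) exprM.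
  have [p [q [cp cq _ _ [c c0 E]]]] := residual_surj smF char2 cx.
  by exists p, q; split=> //; rewrite E (dhomog_scale _ _ homP) mulf_neq0 ?expf_neq0.
have [w0 /row_nz[i wi]] := third_nz.
move=> /eqP; apply; move: w.
apply: (polyfun_domain (polymap_third i) PP); last by exists w0.
move=> w; have [->|w3] := eqVneq (third w) 0; first by rewrite mxE mul0r.
by rewrite PV ?mulr0.
Qed.

(** Where the legs of [w] and of its translate are in general position this is
[residual_natural]; the minors expressing it are polynomials, hence vanish at all
other vectors. *)
Lemma third_equivariant g w : g \in G -> third w != 0 -> third (w *m induced g) != 0 ->
  exists2 c, c != 0 & third (w *m induced g) = c *: Phi g (third w).
Proof.
move=> Gg w3 wg3; have ct : cone (third w) by split=> //; apply: F_third.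
have [d' [e' [e'R e'w]]] := (Phi_regular Gg).2 _ ct.
have [b b0 bE] := e'R.2 _ ct e'w.
suff /(colinearP e'w)[c cE] : colinear (peval e' (third w)) (third (w *m induced g)).
  exists (c / b); last by rewrite cE bE scalerA divfK.
  by rewrite mulf_neq0 ?invr_eq0 //; apply: contraNneq wg3 => c0; rewrite cE c0 scale0r.
move=> i j; apply/eqP; rewrite -subr_eq0; apply/eqP.
(* One of [A] and [B] vanishes where a leg does, and where the third point is one
   of the legs. *)
pose A w := dF (leg1 w) (leg2 w); pose B w := dF (leg2 w) (leg1 w).
have Pg : polymap (fun w => w *m induced g) by apply: polymap_mulmx.
have PA : polyfun A by apply: polyfun_dF; [apply: polymap_leg1|apply: polymap_leg2].
have PB : polyfun B by apply: polyfun_dF; [apply: polymap_leg2|apply: polymap_leg1].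
have PAg : polyfun (fun w => A (w *m induced g)) by apply: polyfun_comp.
have [wAB AB0] := dF_legs_nz.
have nzAg : exists w, A (w *m induced g) != 0.
  exists (wAB *m induced g^-1%g).
  by rewrite repr_mxKV //; apply: contraNneq AB0; rewrite /A => ->; rewrite mul0r.
have nzABA : exists w, A w * B w * A (w *m induced g) != 0.
  by apply: polyfun_nonzeroM => //; [apply: polyfunM|exists wAB].
have Pe' : polymap (fun w => peval e' (third w)).
  exact: polymap_comp (polymap_peval e') polymap_third.
have Ptg : polymap (fun w => third (w *m induced g)).
  exact: polymap_comp polymap_third Pg.
move: w {w3 wg3 ct e'w bE}.
apply: (polyfun_domain _ _ _ nzABA).
- by apply: polyfunM => //; apply: polyfunM.
- by apply: polyfunD; [|apply: polyfunN]; apply: polyfunM.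
move=> w; have [->|] := eqVneq (A w * B w * A (w *m induced g)) 0; first by rewrite mul0r.
rewrite !mulf_eq0 !negb_or => /andP[/andP[A0 B0] Ag0].
have [w1 w2] := leg_dF_nz A0; have [wg1 wg2] := leg_dF_nz Ag0.
have c1 := f_cone w1 : cone (leg1 w); have c2 := leg2_cone w2.
have [a1 [a2 legs]] := legs_permuted Gg w1 w2 wg1 wg2.
have [c cE] := residual_natural smF char2 a1 a2 (Phi_regular Gg)
  (Phi_regular (groupVr Gg)) (fun x => PhiK Gg) c1 c2 A0 B0.
have [a aE] : exists a, third (w *m induced g) = a *: Phi g (third w).
  case: legs => -[E1 E2]; first by exists c; rewrite /third E1 E2.
  by exists (- c); rewrite /third E1 E2 residualC cE scaleNr.
have ct := residual_cone smF c1 c2 A0 B0 : cone (third w).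
have [e'0|e'w] := eqVneq (peval e' (third w)) 0.
  by rewrite !e'0 !mxE !mul0r subrr mulr0.
have [b' b'0 b'E] := e'R.2 _ ct e'w.
by rewrite aE b'E !mxE; ring.
Qed.

(** The induced representation is faithful because an element acting trivially on
it fixes the third points, which are dense in the surface. *)
Theorem third_unirational : unirational G to.
Proof.
have [h hE] := polymapE polymap_third.
exists (n + n)%N, induced, h.
have eqv : equivariant to induced h.
  move=> g Gg w x; rewrite -!hE => w3 wg3 xw.
  have [c c0 ->] := third_equivariant Gg w3 wg3.
  by rewrite vlineZ // (lifts_line (PhiL g) xw).
have rat : rational_map_to F h.
  split=> [|w]; last by rewrite -hE F_third.
  have [w /row_nz[i wi]] := third_nz; exists i; apply: contraNneq wi => hi.
  by rewrite hE mxE hi meval0.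
split=> //; last first.
  move=> d' P homP PV x; apply: (third_dominant homP) (coords_cone x) => w w3.
  by rewrite hE PV // -hE.
apply/subsetP => g /rkerP[Gg g1]; rewrite inE; apply/eqP; apply: toF => // x.
have cx := coords_cone x; have [d' [e' [e'R e'x]]] := (Phi_regular Gg).2 _ cx.
have col : colinear (coords x) (peval e' (coords x)).
  move=> i j; apply/eqP; rewrite -subr_eq0 !mxE.
  have -> : coords x 0 i * (e' j).@[coords x 0] - coords x 0 j * (e' i).@[coords x 0] =
     ('X_i * e' j - 'X_j * e' i).@[coords x 0] by rewrite mevalB !mevalM !mevalXU.
  apply/eqP; apply: (@third_dominant d'.+1) => // [|w w3].
    by rewrite -[d'.+1]add1n; apply: rpredB; apply: dhomogM (e'R.1 _);
      rewrite dhomogX /= mdeg1.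
  have ct : cone (third w) by split=> //; apply: F_third.
  have [|c c0] := third_equivariant Gg w3; rewrite g1 mulmx1 // => E.
  rewrite mevalB !mevalM !mevalXU.
  have [e'0|e'w] := eqVneq (peval e' (third w)) 0.
    have z k : (e' k).@[third w 0] = 0.
      by have := congr1 (fun v : 'rV[K]_4 => v 0 k) e'0; rewrite !mxE.
    by rewrite !z !mulr0 subrr.
  have [b b0 bE] := e'R.2 _ ct e'w.
  have z k : third w 0 k = c * b * (e' k).@[third w 0].
    by rewrite {1}E bE !mxE mulrA.
  by rewrite !z; ring.
have [c cE] := colinearP cx.1 col; have [b b0 bE] := e'R.2 _ cx e'x.
apply: val_inj; rewrite -!/(line _) (lifts_line (PhiL g) (line_coords x)).
rewrite [RHS]line_coords bE cE scalerA vlineZ // mulf_neq0 //.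
by apply: contraNneq e'x => c0; rewrite cE c0 scale0r.
Qed.

End Main.

(** * Unirationality for the larger group *)

Local Close Scope ring_scope.

Theorem theorem3p2 (R : realType) (F : {mpoly R[i][4]})
    (gT : finGroupType) (G H : {group gT}) (to : action G (surface F)) :
  smooth_cubic F ->
  regular_action to ->
  faithful_action to ->
  H \subset G ->
  #|G : H|%g = 2 ->
  unirational H to ->
  unirational G to.
Proof.
move=> smF toR toF sHG idx [n [rH [f [_ ratf dom eqf]]]].
have char2 : (2%:R != 0 :> R[i])%R by rewrite Num.Theory.pnatr_eq0.
have /choice[Phi PhiL] g := lifts_exist (fun x : surface F => to x g).
have /subsetPn[s Gs nHs] : ~~ (G \subset H).
  apply/negP => sGH; have GH : G = H by apply/val_inj/eqP; rewrite eqEsubset sGH.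
  by move: idx; rewrite GH indexgg.
have [x cx] := cone_exists smF.
have [d [e [eR ex]]] := regular_lift_pos (Phi_regular smF toR PhiL Gs) cx.
exact: (third_unirational smF char2 toR toF sHG idx PhiL ratf dom eqf Gs nHs eR
  (ex_intro2 _ _ x cx ex)).
Qed.
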